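(* Let $G$ be a plane graph and let $e = v_1v_2$ be a boundary edge of $G$. Then there is an orientation $D$ of $G - e$ such that: (i) $|EE(D)| \neq |OE(D)|$; (ii) $d_D^+(v_1) = d_D^+(v_2) = 0$, $d_D^+(v) \le 2$ for every boundary vertex $v \notin \{v_1,v_2\}$, and $d_D^+(v) \le 4$ for every interior vertex $v$.
   Context: A plane graph is a finite simple graph embedded in the plane. Boundary vertices and boundary edges are those lying on the outer (unbounded) face; all other vertices are interior vertices. For a digraph $D$, $d_D^+(v)$ denotes the out-degree of $v$. A spanning sub-digraph $H$ of $D$ (same vertex set, any subset of arcs) is Eulerian if $d_H^+(v) = d_H^-(v)$ for every vertex $v$. $EE(D)$ (respectively $OE(D)$) denotes the set of spanning Eulerian sub-digraphs of $D$ with an even (respectively odd) number of arcs. *)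

(* Defs.v *)
From HB Require Import structures.
From mathcomp Require Import all_boot all_order all_algebra.
From mathcomp Require Import all_classical all_reals all_analysis.

Set Implicit Arguments.
Unset Strict Implicit.
Unset Printing Implicit Defensive.

Import Order.TTheory GRing.Theory Num.Theory.
Import numFieldNormedType.Exports.

Record sgraph := SGraph {
  vert :> finType;
  adj : rel vert;
  adj_sym : symmetric adj;
  adj_irr : irreflexive adj }.

Section DeleteEdge.
Variables (G : sgraph) (u v : G).

Definition del_edge_adj : rel G :=
  fun x y => adj x y && ([set x; y] != [set u; v])%SET.

Lemma del_edge_sym : symmetric del_edge_adj.
Proof. by move=> x y; rewrite /del_edge_adj adj_sym finset.setUC. Qed.

Lemma del_edge_irr : irreflexive del_edge_adj.
Proof. by move=> x; rewrite /del_edge_adj adj_irr. Qed.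

Definition del_edge : sgraph := SGraph del_edge_sym del_edge_irr.

End DeleteEdge.

(* A digraph on the vertex set T is given by its arc set; the arc (x, y) goes
   from x to y. Spanning sub-digraphs of D are then the subsets of D. *)
Section Digraph.
Variable T : finType.
Implicit Types D H : {set T * T}.

Definition outdeg D (v : T) : nat := #|[set a in D | a.1 == v]%SET|.
Definition indeg D (v : T) : nat := #|[set a in D | a.2 == v]%SET|.

Definition eulerian D : bool := [forall v, outdeg D v == indeg D v].

Definition EE D : {set {set T * T}} :=
  [set H : {set T * T} | [&& H \subset D, eulerian H & ~~ odd #|H|]]%SET.
Definition OE D : {set {set T * T}} :=
  [set H : {set T * T} | [&& H \subset D, eulerian H & odd #|H|]]%SET.

End Digraph.

Definition orientation (G : sgraph) (D : {set G * G}) : Prop :=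
  (forall x y, (x, y) \in D -> adj x y) /\
  (forall x y : G, adj x y -> ((x, y) \in D) (+) ((y, x) \in D)).

Local Open Scope classical_set_scope.
Local Open Scope ring_scope.

Definition is_arc (R : realType) (p q : R * R) (A : set (R * R)) : Prop :=
  exists f : R -> R * R,
    [/\ {within `[0, 1], continuous f},
        {in `[0, 1] &, injective f},
        f 0 = p, f 1 = q & A = f @` `[0, 1]].

Definition frontier (T : topologicalType) (A : set T) : set T :=
  closure A `\` interior A.

(* edge_arc is only meaningful on adjacent pairs; edge_arc u v and
   edge_arc v u are the same subset of the plane. *)
Record plane_graph (R : realType) := PlaneGraph {
  pgraph :> sgraph;
  pt : pgraph -> R * R;
  edge_arc : pgraph -> pgraph -> set (R * R);
  pt_inj : injective pt;
  edge_arcC : forall u v, adj u v -> edge_arc u v = edge_arc v u;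
  edge_arcP : forall u v, adj u v -> is_arc (pt u) (pt v) (edge_arc u v);
  edge_arc_pt : forall u v w, adj u v ->
    ~ (edge_arc u v `\` [set pt u; pt v]) (pt w);
  edge_arc_disj : forall u v x y, adj u v -> adj x y ->
    ([set u; v] != [set x; y])%SET ->
    (edge_arc u v `\` [set pt u; pt v]) `&` edge_arc x y = set0 }.

Section Boundary.
Variables (R : realType) (G : plane_graph R).

Definition drawing : set (R * R) :=
  range (@pt R G) `|`
  [set p | exists u v : G, adj u v /\ edge_arc u v p].

(* The complement of the drawing has exactly one unbounded component, so this
   set is that component. *)
Definition outer_face : set (R * R) :=
  [set p | (~` drawing) p /\
           ~ bounded_set (connected_component (~` drawing) p)].

Definition boundary_vertex (v : G) : Prop := frontier outer_face (pt v).

Definition interior_vertex (v : G) : Prop := ~ boundary_vertex v.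

Definition boundary_edge (u v : G) : Prop :=
  adj u v /\ edge_arc u v `<=` frontier outer_face.

End Boundary.

(* Main.v *)
Require Import Defs.
From mathcomp Require Import all_boot all_order all_algebra.
From mathcomp Require Import boolp zify.

(** By Alon and Tarsi, [|EE D| - |OE D|] is up to sign the coefficient of the monomial with
    exponents [outdeg D] in the graph polynomial, so it suffices to find a suitable monomial
    with nonzero coefficient, and adding edges or vertices only makes this harder.

    A fine grid turns the drawing into a partition of the triangular lattice into connected
    regions: one for each vertex (a star of arc thirds), one region [z] for the outer face, and
    singletons. Adjacent vertices get adjacent regions and boundary vertices get regions adjacent
    to [z]. Such adjacency graphs are stable under contraction of connected sets, and the
    parity of crossings of a closed lattice walk with rays shows: along an interface between two
    regions [u] and [v] with ends in regions [p] and [q], every cycle through the edge [u v]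
    avoiding [p] and [q] separates [p] from [q].

    These two facts replace plane topology in the induction of Thomassen and Zhu: a chord of the
    neighbourhood of [z] splits the graph and the monomials multiply; without chords a boundary
    neighbour [v] of [v1] is absorbed into [z]. *)

Set Implicit Arguments.
Unset Strict Implicit.
Unset Printing Implicit Defensive.
Import Order.TTheory GRing.Theory Num.Theory.
Local Open Scope ring_scope.

(** * Coefficients of the graph polynomial *)

Section Coefficients.
Variable W : finType.
Implicit Types (L : seq (W * W)) (U : seq W) (d : {ffun W -> int}) (u v x y : W).

Definition delta x : {ffun W -> int} := [ffun y => (y == x)%:Z].

Lemma exponentD d d' x : (d + d') x = d x + d' x. Proof. by rewrite ffunE. Qed.
Lemma exponentB d d' x : (d - d') x = d x - d' x. Proof. by rewrite !ffunE. Qed.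
Lemma exponent0 x : (0 : {ffun W -> int}) x = 0. Proof. by rewrite ffunE. Qed.

Definition exponentE := (exponentB, exponentD, exponent0, ffunE).

(* The coefficient of the monomial with exponent vector [d] in the product of the
   [x_u - x_v] over [L]. Exponents range over [int] so that the recursion needs no side
   condition; the coefficient vanishes as soon as an exponent is negative. *)
Fixpoint coef L d : int :=
  if L is (u, v) :: L' then coef L' (d - delta u) - coef L' (d - delta v)
  else (d == 0)%:R.

Lemma coef_cons_neq0 u v L d : coef ((u, v) :: L) d != 0 ->
  exists2 w, (w == u) || (w == v) & coef L (d - delta w) != 0.
Proof.
move=> /= coef_neq0.
have [coefu0|] := eqVneq (coef L (d - delta u)) 0; last by exists u; rewrite ?eqxx.
by exists v; rewrite ?eqxx ?orbT //; rewrite coefu0 sub0r oppr_eq0 in coef_neq0.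
Qed.

Lemma coef_ge0 L d x : coef L d != 0 -> 0 <= d x.
Proof.
elim: L d => [|[u v] L IH] d.
  by rewrite /=; have [->|] := eqVneq d 0; rewrite ?eqxx // ffunE.
by case/coef_cons_neq0 => w _ /IH; rewrite !exponentE; lia.
Qed.

Lemma coef_lt0 L d x : d x < 0 -> coef L d = 0.
Proof. by move=> dx_lt0; apply/eqP; apply: contraTT dx_lt0 => /coef_ge0 dx_ge0; rewrite -leNgt. Qed.

Lemma coef_support L d x : {in L, forall a, (a.1 != x) && (a.2 != x)} ->
  coef L d != 0 -> d x = 0.
Proof.
elim: L d => [|[u v] L IH] d Lx.
  by rewrite /=; have [->|] := eqVneq d 0; rewrite ?eqxx // ffunE.
case/coef_cons_neq0 => w wuv /IH.
have -> : (d - delta w) x = d x.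
  rewrite !exponentE [x == w](_ : _ = false) ?subr0 //; apply: contraTF wuv => /eqP <-.
  by have /= /andP[] := Lx (u, v) (mem_head _ _); rewrite ![x == _]eq_sym => /negPf -> /negPf ->.
by apply => a aL; apply: Lx; rewrite inE aL orbT.
Qed.

Lemma sum_sub_delta (P : pred W) d x :
  \sum_(y | P y) (d - delta x) y = \sum_(y | P y) d y - (P x)%:Z.
Proof.
under eq_bigr do rewrite !exponentE.
rewrite big_split sumrN /=; congr (_ - _).
rewrite big_mkcond (bigD1 x) //= eqxx big1 ?addr0; first by case: (P x).
by move=> y /negPf ->; case: ifP.
Qed.

Lemma coef_degree L d : coef L d != 0 -> \sum_x d x = (size L)%:Z.
Proof.
elim: L d => [|[u v] L IH] d.
  rewrite /=; have [-> _|] := eqVneq d 0; last by rewrite eqxx.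
  by rewrite big1 // => x _; rewrite ffunE.
by case/coef_cons_neq0 => w _ /IH; rewrite sum_sub_delta /=; lia.
Qed.

Lemma coef_perm L L' d : perm_eq L L' -> coef L d = coef L' d.
Proof.
have rot1 K a K' d' : coef (a :: K ++ K') d' = coef (K ++ a :: K') d'.
  elim: K d' => [//|[u v] K IH] d'; case: a IH => x y IH.
  rewrite !cat_cons /= -!IH /= ![d' - delta x - _]addrAC ![d' - delta y - _]addrAC.
  rewrite !opprB addrACA [RHS]addrACA; congr (_ + _); exact: addrC.
elim: L L' d => [|a L IH] L' d pLL'.
  by move/perm_size: pLL' => /= /esym/eqP/nilP ->.
have /path.splitPr aL' : a \in L' by rewrite -(perm_mem pLL') mem_head.
case: aL' pLL' => K K'; rewrite -rot1 => pLL'.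
have {}pLL' : perm_eq L (K ++ K').
  rewrite -(perm_cons a); apply: perm_trans pLL' _.
  by rewrite -[a :: K']cat1s -[a :: _]cat1s perm_catCA.
by case: a => u v /=; rewrite !(IH _ _ pLL').
Qed.

Lemma coef_cat_neq0 L L' d : coef (L ++ L') d != 0 ->
  exists2 d', coef L' d' != 0 & forall x, d' x <= d x.
Proof.
elim: L d => [|[u v] L IH] d; first by exists d.
case/coef_cons_neq0 => w _ /IH[d' coefd' d'le]; exists d' => // x.
by have := d'le x; rewrite !exponentE; lia.
Qed.

Lemma coef_cons_root u r L d : d r = 0 -> u != r ->
  coef ((u, r) :: L) (d + delta u) = coef L d.
Proof.
move=> dr0 ur; rewrite /= addrK (@coef_lt0 _ (_ - delta r) r) ?subr0 //.
by rewrite !exponentE dr0 eqxx eq_sym (negPf ur).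
Qed.

Definition restrict (Q : {set W}) d : {ffun W -> int} := [ffun x => if x \in Q then d x else 0].

Lemma coef_restrictC (Q : {set W}) L d : {in Q, forall x, d x = 0} ->
  coef L (restrict (~: Q) d) = coef L d.
Proof.
move=> dQ0; congr coef; apply/ffunP => x; rewrite ffunE inE.
by case: ifPn => // /negPn /dQ0.
Qed.

Section Separated.
Variables (Q : {set W}) (L' : seq (W * W)).
Hypothesis L'Q : {in L', forall a, (a.1 \notin Q) && (a.2 \notin Q)}.

Lemma coef_avoiding d x : x \in Q -> coef L' d != 0 -> d x = 0.
Proof.
move=> xQ; apply: coef_support => a /L'Q /andP[aQ bQ].
by apply/andP; split; [apply: contraNneq aQ|apply: contraNneq bQ] => ->.
Qed.

Lemma coef_cat_crowded L d :
  (size L)%:Z < \sum_(x in Q) d x -> coef (L ++ L') d = 0.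
Proof.
elim: L d => [|[u v] L IH] d /= size_lt.
  apply: contraTeq size_lt => coef_neq0; rewrite big1 // => x xQ.
  exact: coef_avoiding coef_neq0.
by rewrite !IH ?subrr // sum_sub_delta /=; case: (_ \in Q); lia.
Qed.

(* If the degree in [Q] is the number of edges of [L], every edge of [L] contributes an end
   in [Q]. *)
Lemma coef_cat_separated L d : \sum_(x in Q) d x = (size L)%:Z ->
  coef (L ++ L') d = coef L (restrict Q d) * coef L' (restrict (~: Q) d).
Proof.
elim: L d => [|[u v] L IH] d /= sumd.
  have [restrict0|restrict_neq0] := eqVneq (restrict Q d) 0.
    rewrite mul1r coef_restrictC // => x xQ.
    by move/ffunP: restrict0 => /(_ x); rewrite !exponentE xQ.
  rewrite mul0r; apply: contraNeq restrict_neq0 => coef_neq0.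
  apply/eqP/ffunP => x; rewrite !exponentE; case: ifP => // xQ.
  exact: coef_avoiding coef_neq0.
suff choose w : coef (L ++ L') (d - delta w) =
    coef L (restrict Q d - delta w) * coef L' (restrict (~: Q) d).
  by rewrite !choose mulrBl.
have [wQ|wQ] := boolP (w \in Q).
  rewrite IH; last by rewrite sum_sub_delta sumd wQ; lia.
  congr (coef _ _ * coef _ _); apply/ffunP => x; rewrite !exponentE ?inE.
    by case: ifP => // xQ; rewrite (_ : (x == w) = false) ?subr0 //; apply: contraFF xQ => /eqP ->.
  case: ifP => // xQ; rewrite (_ : (x == w) = false) ?subr0 //; apply: contraTF xQ => /eqP ->.
  by rewrite wQ.
rewrite coef_cat_crowded; last by rewrite sum_sub_delta sumd (negPf wQ); lia.
by rewrite (@coef_lt0 _ (_ - delta w) w) ?mul0r // !exponentE (negPf wQ) eqxx.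
Qed.

End Separated.

Definition star_edges v U : seq (W * W) := [seq (v, x) | x <- U].
Definition multiplicity U : {ffun W -> int} := [ffun x => (count_mem x U)%:Z].

Lemma multiplicity_cons y U : multiplicity (y :: U) = delta y + multiplicity U.
Proof. by apply/ffunP => x; rewrite !exponentE /= eq_sym PoszD. Qed.

Lemma coef_star_edges v U L d : v \notin U -> d v = 0 ->
  coef (star_edges v U ++ L) (d + multiplicity U) = (-1) ^+ size U * coef L d.
Proof.
elim: U => [|y U IH].
  by rewrite mul1r (_ : multiplicity _ = 0) ?addr0 //; apply/ffunP => x; rewrite !exponentE.
rewrite inE negb_or => /andP[vy vU] dv0 /=.
have vU0 : (count_mem v U) = 0%N by apply/count_memPn.
rewrite (@coef_lt0 _ (_ - delta v) v); last by rewrite !exponentE /= dv0 vU0 eq_sym (negPf vy) eqxx.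
by rewrite multiplicity_cons addrCA [delta y + _]addrC addrK IH // exprS mulN1r mulNr sub0r.
Qed.

Lemma coef_star_center v U L d : v \notin U -> {in L, forall a, (a.1 != v) && (a.2 != v)} ->
  d v = 0 -> coef (star_edges v U ++ L) (d + multiplicity U + delta v) != 0 ->
  exists2 u, u \in U & coef L (d + delta u) != 0.
Proof.
elim: U d => [|y U IH] d.
  move=> _ Lv dv0 /(coef_support Lv); rewrite !exponentE dv0 eqxx; lia.
rewrite inE negb_or => /andP[vy vU] Lv dv0.
rewrite /= addrK.
have -> : d + multiplicity (y :: U) + delta v - delta y = d + multiplicity U + delta v.
  by rewrite multiplicity_cons; apply/ffunP => x; rewrite !exponentE; lia.
have [-> |/IH[] // u uU coefu _] :=
  eqVneq (coef (star_edges v U ++ L) (d + multiplicity U + delta v)) 0.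
  rewrite subr0 multiplicity_cons addrA coef_star_edges //; last first.
    by rewrite !exponentE dv0 (negPf vy).
  by rewrite mulf_eq0 signr_eq0 /= => coefy; exists y; rewrite ?mem_head.
by exists u; rewrite // inE uU orbT.
Qed.

(* If the natural exponent vector fails, cancellation forces another monomial in which
   some [u] gains and [w] loses one; then [w] can afford to be oriented towards [v]. *)
Lemma coef_star_switch v w U L d : v \notin w :: U ->
  {in L, forall a, (a.1 != v) && (a.2 != v)} -> d v = 0 -> coef L d != 0 ->
  coef (star_edges v (w :: U) ++ L) (d + multiplicity U + delta v) != 0 \/
  exists2 u, u \in U & coef (star_edges v (w :: U) ++ L) (d + multiplicity U + delta u) != 0.
Proof.
move=> vwU Lv dv0 coefd; have := vwU; rewrite inE negb_or => /andP[vw vU].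
have [coef0|] := eqVneq (coef (star_edges v (w :: U) ++ L) (d + multiplicity U + delta v)) 0;
  [right|by left].
have coefw : coef (star_edges v U ++ L) (d + multiplicity U + delta v - delta w) =
    (-1) ^+ size U * coef L d.
  by apply/esym/eqP; rewrite -subr_eq0 -(coef_star_edges L vU dv0) -coef0 /= addrK.
have [||||u uU coefu] := @coef_star_center v U L (d - delta w) => //.
- by rewrite !exponentE dv0 (negPf vw).
- by rewrite [d - _ + _]addrAC [_ - _ + delta v]addrAC coefw mulf_neq0 // signr_eq0.
exists u => //; have vu : v != u by apply: contraNneq vU => ->.
have -> : d + multiplicity U + delta u = d - delta w + delta u + multiplicity (w :: U).
  by rewrite multiplicity_cons; apply/ffunP => x; rewrite !exponentE; lia.
rewrite coef_star_edges //; last first.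
  by rewrite !exponentE dv0 (negPf vw) (negPf vu).
by rewrite mulf_neq0 // signr_eq0.
Qed.

End Coefficients.

Definition same_pair (T : eqType) (a b x y : T) : bool :=
  (x == a) && (y == b) || (x == b) && (y == a).

Lemma same_pairC (T : eqType) (a b : T) : same_pair a b =2 same_pair b a.
Proof. by move=> x y; rewrite /same_pair orbC. Qed.

Lemma same_pair_sym (T : eqType) (a b : T) : symmetric (same_pair a b).
Proof. by move=> x y; rewrite /same_pair orbC ![(y == _) && _]andbC. Qed.

Section GraphOperations.
Variable W : finType.
Implicit Types (e : rel W) (u v w x y : W) (K U : {set W}).

Definition remove_edge e u v : rel W := fun x y => e x y && ~~ same_pair u v x y.
Definition remove_vertices e K : rel W := fun x y => [&& e x y, x \notin K & y \notin K].
Definition edges_at e U : rel W := fun x y => e x y && ((x \in U) || (y \in U)).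

Lemma remove_edge_sym e u v : symmetric e -> symmetric (remove_edge e u v).
Proof. by move=> e_sym x y; rewrite /remove_edge e_sym same_pair_sym. Qed.

Lemma remove_edge_irr e u v : irreflexive e -> irreflexive (remove_edge e u v).
Proof. by move=> e_irr x; rewrite /remove_edge e_irr. Qed.

Lemma remove_vertices_sym e K : symmetric e -> symmetric (remove_vertices e K).
Proof. by move=> e_sym x y; rewrite /remove_vertices e_sym [(x \notin K) && _]andbC. Qed.

Lemma remove_vertices_irr e K : irreflexive e -> irreflexive (remove_vertices e K).
Proof. by move=> e_irr x; rewrite /remove_vertices e_irr. Qed.

End GraphOperations.

Section Monomials.
Variable W : finType.
Implicit Types (L : seq (W * W)) (e : rel W) (d m : {ffun W -> int}) (u v w x y : W).
Implicit Types (U : {set W}) (b : W -> int).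

Definition edge_list L e :=
  forall x y, (count_mem (x, y) L + count_mem (y, x) L)%N = e x y.

Lemma coef_swap u v L d : coef ((v, u) :: L) d = - coef ((u, v) :: L) d.
Proof. by rewrite /= opprB. Qed.

Lemma edge_list_coef_sign L L' e : edge_list L e -> edge_list L' e ->
  exists s : bool, forall d, coef L d = (-1) ^+ s * coef L' d.
Proof.
move=> Le L'e.
have {Le L'e} : forall x y, (count_mem (x, y) L + count_mem (y, x) L =
   count_mem (x, y) L' + count_mem (y, x) L')%N by move=> x y; rewrite Le L'e.
elim: L L' => [|[u v] L IH] L' countLL'.
  have -> : L' = [::] by case: L' countLL' => // -[x y] L' /(_ x y); rewrite /= eqxx; lia.
  by exists false => d; rewrite expr0 mul1r.
have [a auv aL'] : exists2 a, a = (u, v) \/ a = (v, u) & a \in L'.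
  have : ((u, v) \in L') || ((v, u) \in L').
    by rewrite -!has_pred1 !has_count; have := countLL' u v; rewrite /= eqxx; lia.
  by case/orP; [exists (u, v); [left|]|exists (v, u); [right|]].
have [|s coefL] := IH (rem a L').
  move=> x y; have := countLL' x y; rewrite !(permP (perm_to_rem aL')) /=.
  by case: auv => ->; rewrite !xpair_eqE; lia.
case: auv => aE; rewrite aE in aL' coefL.
  by exists s => d; rewrite (coef_perm d (perm_to_rem aL')) /= !coefL mulrBr.
exists (~~ s) => d; rewrite (coef_perm d (perm_to_rem aL')) [in RHS]coef_swap /= !coefL.
by rewrite signrN mulNr mulrN opprK mulrBr.
Qed.

Lemma edge_list_mem L e a : edge_list L e -> a \in L -> e a.1 a.2.
Proof.
case: a => x y Le; rewrite -has_pred1 has_count; move: (Le x y) => /=.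
by case: (e x y) => //; lia.
Qed.

Lemma edge_list_sym L e : edge_list L e -> symmetric e.
Proof. by move=> Le x y; have := Le x y; rewrite addnC Le; do 2 case: (e _ _). Qed.

Lemma edge_list_exists e : symmetric e -> irreflexive e -> exists L, edge_list L e.
Proof.
move=> e_sym e_irr.
exists [seq a <- index_enum (W * W)%type | e a.1 a.2 && (enum_rank a.1 < enum_rank a.2)%N] => x y.
rewrite !count_uniq_mem ?filter_uniq ?index_enum_uniq //.
rewrite !mem_filter /= !mem_index_enum !andbT (e_sym y x).
have [exy|//] := boolP (e x y).
have : x != y by apply: contraTneq exy => ->; rewrite e_irr.
by rewrite -(inj_eq enum_rank_inj) -val_eqE /=; case: ltngtP.
Qed.

Lemma edge_list_cons u v L e : symmetric e -> irreflexive e -> e u v ->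
  edge_list L (remove_edge e u v) -> edge_list ((u, v) :: L) e.
Proof.
move=> e_sym e_irr euv Le x y; have := Le x y; rewrite /= /remove_edge /same_pair !xpair_eqE.
have neq_uv : (u == v) = false by apply: contraTF euv => /eqP ->; rewrite e_irr.
rewrite ![u == _]eq_sym ![v == _]eq_sym [(y == u) && _]andbC.
have [/andP[/eqP -> /eqP ->]|_] := boolP ((x == u) && (y == v)).
  by rewrite neq_uv andbF euv; lia.
have [/andP[/eqP -> /eqP ->]|_] := boolP ((x == v) && (y == u)); last by rewrite andbT; lia.
by rewrite e_sym euv; lia.
Qed.

Lemma edge_list_add_star v (N : seq W) L e : symmetric e -> irreflexive e -> uniq N -> N =i e v ->
  edge_list L (remove_vertices e [set v]) -> edge_list (star_edges v N ++ L) e.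
Proof.
move=> e_sym e_irr uniqN NE Le x y; have := Le x y; rewrite !count_cat /remove_vertices !inE.
have count_star p q : count_mem (p, q) (star_edges v N) = (v == p) && e v q.
  rewrite count_map; have [<-|/negPf vp] /= := eqVneq v p; last first.
    by rewrite -(count_pred0 N); apply: eq_count => z /=; rewrite xpair_eqE vp.
  rewrite (eq_count (a2 := pred1 q)); first by rewrite count_uniq_mem // NE.
  by move=> z /=; rewrite xpair_eqE eqxx.
rewrite !count_star ![v == _]eq_sym.
by case: (eqVneq x v) => [->|_]; case: (eqVneq y v) => [->|_] /=;
  rewrite ?e_irr ?(e_sym v) ?andbF ?andbT /=; lia.
Qed.

Lemma edge_list_avoid L e U : edge_list L (remove_vertices e U) ->
  {in L, forall a, (a.1 \notin U) && (a.2 \notin U)}.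
Proof. by move=> Le a /(edge_list_mem Le) /and3P[_ -> ->]. Qed.

Lemma edge_list_cat L L' e e1 e2 : (forall x y, e x y = e1 x y + e2 x y :> nat)%N ->
  edge_list L e1 -> edge_list L' e2 -> edge_list (L ++ L') e.
Proof. by move=> eE Le1 L'e2 x y; rewrite !count_cat eE -Le1 -L'e2; lia. Qed.

(* The monomial with exponent vector [m] occurs in the graph polynomial of [e]; up to sign the
   coefficient does not depend on the edge list. *)
Definition monomial e m := exists2 L, edge_list L e & coef L m != 0.

Lemma monomial_coef L e m : edge_list L e -> monomial e m -> coef L m != 0.
Proof.
move=> Le [L' L'e]; have [s ->] := edge_list_coef_sign L'e Le.
by rewrite mulf_eq0 signr_eq0.
Qed.

Lemma eq_monomial e e' m : e =2 e' -> monomial e m -> monomial e' m.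
Proof. by move=> ee' [L Le coefL]; exists L => // x y; rewrite Le ee'. Qed.

Lemma monomial_ge0 e m x : monomial e m -> 0 <= m x.
Proof. by case=> L _ /coef_ge0. Qed.

Lemma monomial_isolated e m x : monomial e m -> (forall y, ~~ e x y) -> m x = 0.
Proof.
move=> [L Le coefL] isolated; apply: coef_support coefL => -[a b] abL /=.
have eab := edge_list_mem Le abL; have eba := eab; rewrite (edge_list_sym Le) in eba.
by apply/andP; split; [apply: contraTneq eab|apply: contraTneq eba] => /= ->; apply: isolated.
Qed.

Lemma monomial_edgeless e : (forall x y, ~~ e x y) -> monomial e 0.
Proof. by move=> edgeless; exists [::] => [x y|] /=; rewrite ?(negPf (edgeless _ _)) ?eqxx. Qed.

Lemma monomial_add_edge e u r m : symmetric e -> irreflexive e -> e u r ->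
  monomial (remove_edge e u r) m -> m r = 0 -> monomial e (m + delta u).
Proof.
move=> e_sym e_irr eur [L Le coefL] mr0; exists ((u, r) :: L); first exact: edge_list_cons.
by rewrite coef_cons_root //; apply: contraTneq eur => ->; rewrite e_irr.
Qed.

Definition bounded_monomial e b := exists2 m, monomial e m & forall x, m x <= b x.

Lemma bounded_monomial_le e b b' :
  (forall x, b x <= b' x) -> bounded_monomial e b -> bounded_monomial e b'.
Proof. by move=> bb' [m em mb]; exists m => // x; apply: le_trans (mb x) (bb' x). Qed.

Lemma eq_bounded_monomial e e' b : e =2 e' -> bounded_monomial e b -> bounded_monomial e' b.
Proof. by move=> ee' [m em mb]; exists m => //; apply: eq_monomial em. Qed.

Lemma monomial_add_vertex e v m : symmetric e -> irreflexive e ->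
  monomial (remove_vertices e [set v]) m -> monomial e (m + [ffun x => (e v x)%:Z]).
Proof.
move=> e_sym e_irr em.
have mv0 : m v = 0 by apply: monomial_isolated em _ => y; rewrite /remove_vertices set11 andbF.
case: em => L Le coefL; exists (star_edges v (enum (e v)) ++ L).
  by apply: edge_list_add_star => //; [exact: enum_uniq|exact: mem_enum].
have -> : [ffun x => (e v x)%:Z] = multiplicity (enum (e v)).
  by apply/ffunP => x; rewrite !ffunE count_uniq_mem ?enum_uniq // mem_enum.
rewrite coef_star_edges // ?mulf_neq0 ?signr_eq0 // mem_enum.
by rewrite unfold_in e_irr.
Qed.

Lemma bounded_monomial_add_vertex e v w m : symmetric e -> irreflexive e ->
  monomial (remove_vertices e [set v]) m ->
  bounded_monomial e (fun x => if x == v then 1 else m x + (e v x && (x != w))%:Z *+ 2).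
Proof.
move=> e_sym e_irr em.
have mv0 : m v = 0 by apply: monomial_isolated em _ => y; rewrite /remove_vertices set11 andbF.
have [evw|nevw] := boolP (e v w); last first.
  exists (m + [ffun x => (e v x)%:Z]); first exact: monomial_add_vertex.
  move=> x; rewrite exponentD ffunE; have [->|_] := eqVneq x v; first by rewrite mv0 e_irr.
  by have [->|_] := eqVneq x w; rewrite ?(negPf nevw) ?andbT; lia.
case: em => L Le coefL; have Lv : {in L, forall a, (a.1 != v) && (a.2 != v)}.
  by move=> a /(edge_list_avoid Le); rewrite !in_set1.
pose U := [seq x <- enum W | e v x && (x != w)].
have memU x : (x \in U) = e v x && (x != w) by rewrite mem_filter mem_enum andbT.
have uniqU : uniq U by rewrite filter_uniq // enum_uniq.
have multU x : multiplicity U x = (e v x && (x != w))%:Z by rewrite ffunE count_uniq_mem // memU.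
have NE : w :: U =i e v.
  move=> x; rewrite inE memU [RHS]unfold_in; have [->|_] := eqVneq x w; first by rewrite evw.
  by rewrite andbT.
have uniqN : uniq (w :: U) by rewrite /= uniqU memU eqxx andbF.
have vN : v \notin w :: U by rewrite NE unfold_in e_irr.
have Ne := edge_list_add_star e_sym e_irr uniqN NE Le.
have [coef_neq0|[u uU coef_neq0]] := coef_star_switch vN Lv mv0 coefL.
  exists (m + multiplicity U + delta v); first by exists (star_edges v (w :: U) ++ L).
  move=> x; rewrite !exponentD multU ffunE; have [->|_] := eqVneq x v; last by lia.
  by rewrite mv0 e_irr.
exists (m + multiplicity U + delta u); first by exists (star_edges v (w :: U) ++ L).
move=> x; rewrite !exponentD multU ffunE; have [->|_] := eqVneq x v.
  by rewrite mv0 e_irr; lia.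
by have [->|_] := eqVneq x u; rewrite -?memU ?uU; lia.
Qed.

Lemma bounded_monomial_add_rooted_vertex e v r w m : symmetric e -> irreflexive e -> e v r ->
  monomial (remove_vertices e [set v]) m -> m r = 0 ->
  bounded_monomial e
    (fun x => if x == v then 2 else m x + ([&& e v x, x != r & x != w])%:Z *+ 2).
Proof.
move=> e_sym e_irr evr em mr0; have vr : v != r by apply: contraTneq evr => ->; rewrite e_irr.
have [|d ed d_le] := @bounded_monomial_add_vertex (remove_edge e v r) v w m
    (remove_edge_sym v r e_sym) (remove_edge_irr v r e_irr).
  apply: eq_monomial em => x y; rewrite /remove_vertices /remove_edge /same_pair !inE.
  by case: (e x y) (x == v) (y == v) => [] [] []; rewrite ?andbF.
have {}d_le x : d x <= if x == v then 1 else m x + ([&& e v x, x != r & x != w])%:Z *+ 2.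
  apply: le_trans (d_le x) _; case: (x == v) => //.
  by rewrite /remove_edge /same_pair eqxx (negPf vr) orbF andbA.
have dr0 : d r = 0.
  apply/le_anti; have := d_le r.
  by rewrite (monomial_ge0 r ed) eq_sym (negPf vr) mr0 eqxx andbF => ->.
exists (d + delta v); first exact: (monomial_add_edge e_sym e_irr evr).
move=> x; rewrite exponentD ffunE; have := d_le x; case: eqVneq => _; lia.
Qed.

Lemma bounded_monomial_glue U e b b' c :
  bounded_monomial (remove_vertices e U) b -> bounded_monomial (edges_at e U) b' ->
  (forall x y, e x y -> x \notin U -> y \in U -> b' x <= 0) ->
  (forall x, (if x \in U then b' x else b x) <= c x) -> bounded_monomial e c.
Proof.
move=> [m [L Le coefL] m_le] [m' em' m'_le] b'_le0 c_ge.
have mU0 x : x \in U -> m x = 0.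
  by move=> xU; apply: (coef_avoiding (edge_list_avoid Le) xU coefL).
have m'U0 x : x \notin U -> m' x = 0.
  move=> xU; have [/existsP[y /andP[exy yU]]|isolated] := boolP [exists y, e x y && (y \in U)].
    apply/le_anti; rewrite (monomial_ge0 _ em') andbT.
    exact: le_trans (m'_le x) (b'_le0 x y exy xU yU).
  apply: monomial_isolated em' _ => y; rewrite /edges_at (negPf xU) /=.
  by apply: contra isolated => ?; apply/existsP; exists y.
case: em' => L' L'e coefL'.
exists (m' + m); last first.
  move=> x; apply: le_trans (c_ge x); rewrite exponentD.
  by case: ifPn => xU; [rewrite mU0 // addr0|rewrite m'U0 // add0r].
exists (L' ++ L).
  apply: edge_list_cat L'e Le => x y; rewrite /edges_at /remove_vertices -negb_or.
  by case: (e x y); case: (_ || _).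
rewrite (coef_cat_separated (edge_list_avoid Le)).
  have -> : restrict U (m' + m) = m'.
    apply/ffunP => x; rewrite !exponentE.
    by case: ifPn => xU; [rewrite mU0 ?addr0|rewrite m'U0].
  have -> : restrict (~: U) (m' + m) = m.
    apply/ffunP => x; rewrite !exponentE inE.
    by case: ifPn => [xU|/negPn xU]; [rewrite m'U0 ?add0r|rewrite mU0].
  by rewrite mulf_neq0.
rewrite -(coef_degree coefL') [RHS](bigID (mem U)) /= [X in _ = _ + X]big1 ?addr0.
  by apply: eq_bigr => x xU; rewrite exponentD mU0 ?addr0.
by move=> x /m'U0.
Qed.

End Monomials.

Lemma coef_map (V W : finType) (i : V -> W) (L : seq (V * V)) (d : {ffun W -> int}) :
  injective i -> (forall x, x \notin codom i -> d x = 0) ->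
  coef [seq (i a.1, i a.2) | a <- L] d = coef L [ffun x => d (i x)].
Proof.
move=> i_inj; elim: L d => [|[u v] L IH] d d0 /=.
  congr (nat_of_bool _)%:R; apply/eqP/eqP => [->|/ffunP di0]; apply/ffunP => x; rewrite !ffunE //.
  by have [/codomP[x' ->]|/d0//] := boolP (x \in codom i); have := di0 x'; rewrite !ffunE.
have shift w : coef [seq (i a.1, i a.2) | a <- L] (d - delta (i w)) =
    coef L ([ffun x => d (i x)] - delta w).
  rewrite IH => [|x xi].
    by congr coef; apply/ffunP => x; rewrite !exponentE (inj_eq i_inj).
  rewrite exponentB ffunE d0 // (_ : (x == i w) = false) //; apply: contraNF xi => /eqP ->.
  exact: codom_f.
by rewrite !shift.
Qed.

Lemma monomial_embed (V W : finType) (i : V -> W) (e : rel V) (e' : rel W) (m : {ffun W -> int}) :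
  injective i -> symmetric e -> irreflexive e -> irreflexive e' ->
  {homo i : x y / e x y >-> e' x y} -> monomial e' m ->
  bounded_monomial e (fun x => m (i x)).
Proof.
move=> i_inj e_sym e_irr e'_irr i_homo e'm.
have e'_sym : symmetric e' by case: e'm => L Le _; apply: edge_list_sym Le.
have [L Le] := edge_list_exists e_sym e_irr.
pose image : rel W := fun x y => [exists a, exists b, [&& e a b, x == i a & y == i b]].
have imageE a b : image (i a) (i b) = e a b.
  apply/existsP/idP => [[a' /existsP[b' /and3P[eab /eqP/i_inj -> /eqP/i_inj ->]]]//|eab].
  by exists a; apply/existsP; exists b; rewrite eab !eqxx.
have imageP x y : image x y -> exists a b, [/\ x = i a, y = i b & e a b].
  by move=> /existsP[a /existsP[b /and3P[eab /eqP -> /eqP ->]]]; exists a, b.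
have image_sub x y : image x y -> e' x y by case/imageP => a [b [-> ->]]; apply: i_homo.
have image_sym : symmetric image.
  move=> x y; apply/idP/idP => /imageP[a [b [-> ->]]]; by rewrite imageE e_sym.
pose iL := [seq (i a.1, i a.2) | a <- L].
have iLe : edge_list iL image.
  have count_iL a b : count_mem (i a, i b) iL = count_mem (a, b) L.
    by rewrite count_map; apply: eq_count => -[c d] /=; rewrite !xpair_eqE !(inj_eq i_inj).
  have count_out x y : ~~ image x y -> count_mem (x, y) iL = 0%N.
    move=> nxy; apply/count_memPn; apply: contra nxy => /mapP[a aL [-> ->]].
    by rewrite imageE; apply: edge_list_mem aL.
  move=> x y; have [/imageP[a [b [-> -> eab]]]|nxy] := boolP (image x y).
    by rewrite !count_iL Le eab.
  by rewrite !count_out // image_sym.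
have [|x|L' L'e] := @edge_list_exists _ (fun x y => e' x y && ~~ image x y).
- by move=> x y; rewrite e'_sym image_sym.
- by rewrite e'_irr.
have L'iL : edge_list (L' ++ iL) e'.
  apply: edge_list_cat L'e iLe => x y.
  by case: (boolP (image x y)) => [/image_sub ->|]; rewrite ?andbF ?andbT ?addn0.
have /coef_cat_neq0[d coefd d_le] := monomial_coef L'iL e'm.
exists [ffun x => d (i x)]; last by move=> x; rewrite ffunE.
exists L => //; rewrite -coef_map // => x xi.
apply: monomial_isolated (ex_intro2 _ _ iL iLe coefd) _.
by move=> y; apply: contra xi => /imageP[a [b [-> _ _]]]; apply: codom_f.
Qed.

(** * The Alon-Tarsi criterion *)

Lemma big_subsetU1 (R : Type) (idx : R) (op : Monoid.com_law idx) (T : finType) (a : T)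
    (D : {set T}) (F : {set T} -> R) : a \notin D ->
  \big[op/idx]_(H : {set T} | H \subset a |: D) F H =
  op (\big[op/idx]_(H : {set T} | H \subset D) F H)
     (\big[op/idx]_(H : {set T} | H \subset D) F (a |: H)).
Proof.
move=> aD; rewrite (bigID (fun H : {set T} => a \in H)) /= Monoid.mulmC; congr (op _ _).
  apply: eq_bigl => H; apply/andP/idP => [[HaD aH]|HD].
    by rewrite -(setU1K aD) subsetD1 HaD.
  split; first exact: subset_trans HD (subsetUr _ _).
  by apply: contra aD; apply: (subsetP HD).
rewrite (reindex_onto (fun H : {set T} => a |: H) (fun H => H :\ a)) /=; last first.
  by move=> H /andP[_ aH]; rewrite setD1K.
apply: eq_bigl => H; rewrite setU11 andbT; apply/andP/idP => [[HaD /eqP <-]|HD].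
  by rewrite -(setU1K aD) setSD.
by rewrite setUS // setU1K //; apply: contra aD; apply: (subsetP HD).
Qed.

Section AlonTarsi.
Variable T : finType.
Implicit Types (L : seq (T * T)) (H D : {set T * T}) (e : rel T) (m : {ffun T -> int}).

Definition imbalance H : {ffun T -> int} := \sum_(a in H) (delta a.1 - delta a.2).

Lemma sum_delta_card (P : pred (T * T)) (f : T * T -> T) v :
  (\sum_(a | P a) delta (f a)) v = #|[set a | P a && (f a == v)]|%:Z.
Proof.
rewrite sum_ffunE -sum1_card (big_morph Posz (id1 := 0) (op1 := +%R)) //.
under [RHS]eq_bigl do rewrite inE.
by rewrite big_mkcondr /=; apply: eq_bigr => a _; rewrite ffunE eq_sym; case: eqP.
Qed.

Lemma sum_delta_outdeg D v : (\sum_(a in D) delta a.1) v = (outdeg D v)%:Z.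
Proof. by rewrite sum_delta_card. Qed.

Lemma imbalance_eq0 H : (imbalance H == 0) = eulerian H.
Proof.
have imbalanceE v : imbalance H v = (outdeg H v)%:Z - (indeg H v)%:Z.
  by rewrite /imbalance sumrB exponentB !sum_delta_card.
apply/eqP/forallP => [H0 v|eul].
  by rewrite -eqz_nat -subr_eq0 -imbalanceE H0 exponent0.
by apply/ffunP => v; rewrite imbalanceE exponent0 (eqP (eul v)) subrr.
Qed.

(* Reversing the arcs of [H] changes the sign by [(-1) ^+ #|H|] and the exponents by
   [imbalance H]. *)
Lemma coef_reversals L m : uniq L ->
  coef L (\sum_(a <- L) delta a.1 + m) =
  \sum_(H : {set T * T} | H \subset [set a in L]) (-1) ^+ #|H| * (m + imbalance H == 0)%:R.
Proof.
elim: L m => [|[u v] L IH] m /=.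
  move=> _; rewrite (big_pred1 set0); last first.
    by move=> H; rewrite (_ : [set a in [::]] = set0) ?subset0 //; apply/setP => x; rewrite !inE.
  by rewrite cards0 expr0 mul1r big_nil add0r /imbalance big_set0 addr0.
case/andP=> uvL uniqL; rewrite set_cons big_subsetU1 ?inE //= big_cons /=.
have -> : delta u + \sum_(a <- L) delta a.1 + m - delta u = \sum_(a <- L) delta a.1 + m.
  by rewrite addrAC [delta u + _]addrC addrK.
have -> : delta u + \sum_(a <- L) delta a.1 + m - delta v =
          \sum_(a <- L) delta a.1 + (m + (delta u - delta v)).
  by rewrite [delta u + _]addrC -!addrA; congr (_ + _); rewrite addrCA.
rewrite !IH //; congr (_ + _); rewrite -sumrN; apply: eq_bigr => H HL.
have uvH : (u, v) \notin H by apply: contra uvL => /(subsetP HL); rewrite inE.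
rewrite cardsU1 uvH add1n exprS mulN1r mulNr /imbalance big_setU1 //=.
by rewrite -[m + (delta u - delta v) + _]addrA.
Qed.

Lemma coef_outdeg D :
  coef (enum D) (\sum_(a in D) delta a.1) = #|EE D|%:Z - #|OE D|%:Z.
Proof.
have card_eulerian (P : pred {set T * T}) :
    #|[set H : {set T * T} | [&& H \subset D, eulerian H & P H]]|%:Z =
    \sum_(H : {set T * T} | H \subset D) (eulerian H && P H)%:Z.
  rewrite -sum1dep_card (big_morph Posz (id1 := 0) (op1 := +%R)) // big_mkcondr /=.
  by apply: eq_bigr => H _; case: andP.
rewrite !card_eulerian -sumrB -[X in coef _ X]addr0 -big_enum coef_reversals ?enum_uniq //=.
rewrite set_enum; apply: eq_bigr => H _; rewrite add0r imbalance_eq0 -signr_odd.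
by case: (eulerian H); case: odd.
Qed.

Lemma coef_reorient L m : coef L m != 0 ->
  exists2 L', m = \sum_(a <- L') delta a.1 &
   forall x y, (count_mem (x, y) L' + count_mem (y, x) L' =
                count_mem (x, y) L + count_mem (y, x) L)%N.
Proof.
elim: L m => [|[u v] L IH] m.
  by rewrite /=; have [-> _|] := eqVneq m 0; rewrite ?eqxx //; exists [::]; rewrite ?big_nil.
case/coef_cons_neq0 => w wuv /IH[L' mE countL'].
exists ((w, if w == u then v else u) :: L'); first by rewrite big_cons /= -mE addrC subrK.
move=> x y; have := countL' x y; rewrite /= !xpair_eqE.
by case: eqVneq wuv => [->|_] /=; [|move/eqP->]; lia.
Qed.

Lemma monomial_orientation e m : monomial e m ->
  exists D : {set T * T},
  [/\ forall x y, (x, y) \in D -> e x y,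
      forall x y, e x y -> ((x, y) \in D) (+) ((y, x) \in D),
      #|EE D| <> #|OE D| & forall v, (outdeg D v)%:Z = m v].
Proof.
move=> em; have [L Le coefL] := em; have [L' mE countL'] := coef_reorient coefL.
have L'e : edge_list L' e by move=> x y; rewrite countL' Le.
have count_L' x y : count_mem (x, y) L' = ((x, y) \in L').
  have := L'e x y; have := has_pred1 (x, y) L'; rewrite has_count => <-.
  by case: (count _ _) => [|[|n]] //; case: (e x y).
have uniqL' : uniq L' by apply: count_mem_uniq => -[x y]; apply: count_L'.
pose D := [set a in L'].
have permD : perm_eq (enum D) L'.
  by apply: uniq_perm; rewrite ?enum_uniq // => a; rewrite mem_enum inE.
have {}mE : m = \sum_(a in D) delta a.1 by rewrite mE -big_enum (perm_big _ permD).
exists D; split.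
- by move=> x y; rewrite inE => /(edge_list_mem L'e).
- move=> x y exy; rewrite !inE; have := L'e x y; rewrite !count_L' exy.
  by case: (_ \in _); case: (_ \in _).
- have : coef (enum D) m != 0 by rewrite (coef_perm m permD); apply: monomial_coef em.
  by rewrite mE coef_outdeg => + EO; rewrite EO subrr eqxx.
- by move=> v; rewrite mE sum_delta_outdeg.
Qed.

End AlonTarsi.

(** * The triangular lattice *)

Definition cell := (int * int)%type.

Section Lattice.
Implicit Types (a b c d t : cell) (X : cell -> cell -> bool) (s : seq cell).

Definition forward c : seq cell := [:: (c.1 + 1, c.2); (c.1 + 1, c.2 + 1); (c.1, c.2 + 1)].
Definition adjc c d : bool := (d \in forward c) || (c \in forward d).

Definition cell_nbrs c : seq cell :=
  [:: (c.1 + 1, c.2); (c.1 + 1, c.2 + 1); (c.1, c.2 + 1);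
      (c.1 - 1, c.2); (c.1 - 1, c.2 - 1); (c.1, c.2 - 1)].

(* The common neighbour of [c] and [d] on the left of the directed edge [(c, d)]. *)
Definition left c d : cell :=
  (c.1 + (d.1 - c.1) - (d.2 - c.2), c.2 + (d.1 - c.1)).

Lemma cellP a b : a.1 = b.1 -> a.2 = b.2 -> a = b.
Proof. by case: a b => [? ?] [? ?] /= -> ->. Qed.

Lemma adjc_sym : symmetric adjc.
Proof. by move=> c d; rewrite /adjc orbC. Qed.

Lemma mem_cell_nbrs c d : (d \in cell_nbrs c) = adjc c d.
Proof. case: c d => [c1 c2] [d1 d2]; rewrite /adjc /forward !inE !xpair_eqE /=; lia. Qed.

Lemma adjc_left c d : adjc c d -> adjc c (left c d) && adjc d (left c d).
Proof. case: c d => [c1 c2] [d1 d2]; rewrite /left /adjc /forward !inE !xpair_eqE /=; lia. Qed.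

Lemma left_rot c d : left d (left c d) = c.
Proof. by apply: cellP; rewrite /left /=; lia. Qed.

Lemma left_rotr c d : left (left c d) c = d.
Proof. by apply: cellP; rewrite /left /=; lia. Qed.

Lemma adjc_rotations c d : adjc c d -> exists n, d = iter n (left c) (c.1 + 1, c.2).
Proof.
rewrite -mem_cell_nbrs !in_cons in_nil.
do 6?[case/orP => [/eqP ->|//]];
  [exists 0%N|exists 1%N|exists 2|exists 3|exists 4|exists 5];
  by apply: cellP; rewrite /left /=; lia.
Qed.

(* Three times the barycentre of the triangle on the left of [(c, d)]. *)
Definition barycentre3 c d : cell := (c.1 + d.1 + (left c d).1, c.2 + d.2 + (left c d).2).

(* The step from [a] to [b] crosses the horizontal ray going right from [t / 3]. *)
Definition crosses_ray t a b : bool :=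
  ((3 * a.2 < t.2) (+) (3 * b.2 < t.2)) && (2 * t.1 < 3 * (a.1 + b.1)).

Lemma barycentre3_left c d : barycentre3 c d = barycentre3 d (left c d).
Proof. by rewrite /barycentre3 left_rot; apply: cellP; rewrite /=; lia. Qed.

Lemma crosses_ray_sym t : symmetric (crosses_ray t).
Proof. by move=> a b; rewrite /crosses_ray addbC addrC. Qed.

Lemma cell_eqE a b : (a == b) = (a.1 == b.1) && (a.2 == b.2).
Proof. by []. Qed.

Lemma crosses_ray_row t a : crosses_ray t a (a.1 + 1, a.2) = false.
Proof. by rewrite /crosses_ray addbb. Qed.

Lemma crosses_ray_up t a i k : t.2 = 3 * k + 1 \/ t.2 = 3 * k + 2 ->
  crosses_ray t a (i, a.2 + 1) = (a.2 == k) && (2 * t.1 < 3 * (a.1 + i)).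
Proof.
move=> tE; rewrite /crosses_ray /=; congr (_ && _).
have -> : (3 * a.2 < t.2) = (a.2 <= k) by case: tE => ->; lia.
have -> : (3 * (a.2 + 1) < t.2) = (a.2 < k) by case: tE => ->; lia.
by case: ltgtP.
Qed.

Lemma forward_asym c d : d \in forward c -> c \notin forward d.
Proof.
have height a b : b \in forward a -> a.1 + a.2 < b.1 + b.2.
  by rewrite !inE => /or3P[] /eqP -> /=; lia.
by move=> /height cd; apply/negP => /height dc; have := lt_trans cd dc; rewrite ltxx.
Qed.

Lemma same_pair_forward a b c d : d \in forward c -> b \in forward a ->
  same_pair c d a b = (a == c) && (b == d).
Proof.
move=> fwd_cd fwd_ab; rewrite /same_pair; suff -> : (a == d) && (b == c) = false by rewrite orbF.
by apply: contraTF (forward_asym fwd_cd) => /andP[/eqP <- /eqP <-]; rewrite negbK.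
Qed.

(* The rays from the two triangles at a horizontal edge enclose the cells to its right. *)
Lemma crosses_ray_flip_row c a b : b \in forward a ->
  crosses_ray (barycentre3 c (c.1 + 1, c.2)) a b (+)
  crosses_ray (barycentre3 (c.1 + 1, c.2) c) a b =
  same_pair c (c.1 + 1, c.2) a b (+)
  ((a.2 == c.2) && (c.1 < a.1) (+) (b.2 == c.2) && (c.1 < b.1)).
Proof.
move=> fwd_ab; rewrite same_pair_forward ?mem_head //.
have above : (barycentre3 c (c.1 + 1, c.2)).2 = 3 * c.2 + 1 by rewrite /barycentre3 /left /=; lia.
have below : (barycentre3 (c.1 + 1, c.2) c).2 = 3 * (c.2 - 1) + 2.
  by rewrite /barycentre3 /left /=; lia.
have up_step i : i = a.1 + 1 \/ i = a.1 ->
    crosses_ray (barycentre3 c (c.1 + 1, c.2)) a (i, a.2 + 1) (+)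
    crosses_ray (barycentre3 (c.1 + 1, c.2) c) a (i, a.2 + 1) =
    (a == c) && ((i, a.2 + 1) == (c.1 + 1, c.2)) (+)
    ((a.2 == c.2) && (c.1 < a.1) (+) (a.2 + 1 == c.2) && (c.1 < i)).
  move=> iE; rewrite (crosses_ray_up a i (or_introl above)).
  rewrite (crosses_ray_up a i (or_intror below)).
  have -> : (a == c) && ((i, a.2 + 1) == (c.1 + 1, c.2)) = false.
    by apply/negP => /andP[/eqP -> /eqP[_]]; lia.
  have -> : (a.2 + 1 == c.2) = (a.2 == c.2 - 1) by rewrite eq_sym -subr_eq eq_sym.
  by congr (_ && _ (+) _ && _); rewrite /barycentre3 /left /=; case: iE => -> /=; lia.
move: fwd_ab; rewrite !inE => /or3P[] /eqP -> /=;
  [|by apply: up_step; left|by apply: up_step; right].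
rewrite !crosses_ray_row !cell_eqE.
have [_|] := eqVneq a.2 c.2; last by rewrite !andbF.
by rewrite /= !andbT (inj_eq (addIr 1)) andbb; case: ltgtP => ?; lia.
Qed.

Lemma crosses_ray_flip_up c d a b : d = (c.1 + 1, c.2 + 1) \/ d = (c.1, c.2 + 1) ->
  b \in forward a ->
  crosses_ray (barycentre3 c d) a b (+) crosses_ray (barycentre3 d c) a b = same_pair c d a b.
Proof.
move=> dE fwd_ab; rewrite same_pair_forward //; last by case: dE => ->; rewrite !inE eqxx ?orbT.
have side_cd : (barycentre3 c d).2 = 3 * c.2 + 1 \/ (barycentre3 c d).2 = 3 * c.2 + 2.
  by case: dE => ->; rewrite /barycentre3 /left /=; lia.
have side_dc : (barycentre3 d c).2 = 3 * c.2 + 1 \/ (barycentre3 d c).2 = 3 * c.2 + 2.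
  by case: dE => ->; rewrite /barycentre3 /left /=; lia.
have d2 : d.2 = c.2 + 1 by case: dE => ->.
have up_step i : i = a.1 + 1 \/ i = a.1 ->
    crosses_ray (barycentre3 c d) a (i, a.2 + 1) (+) crosses_ray (barycentre3 d c) a (i, a.2 + 1) =
    (a == c) && ((i, a.2 + 1) == d).
  move=> iE; rewrite (crosses_ray_up a i side_cd) (crosses_ray_up a i side_dc) -andb_addr.
  rewrite !cell_eqE d2.
  have [->|] := eqVneq a.2 c.2; last by rewrite andbF.
  rewrite eqxx !andbT /barycentre3 /left d2 /=; clear side_cd side_dc.
  by case: dE => -> /=; case: iE => -> /=; lia.
move: fwd_ab; rewrite !inE => /or3P[] /eqP ->; rewrite ?up_step //; [|by left|by right].
rewrite !crosses_ray_row; apply/esym/negP => /andP[/eqP -> /eqP cd].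
by move: d2; rewrite -cd /=; lia.
Qed.

Lemma crosses_ray_flip c d : adjc c d -> exists g : cell -> bool, forall a b, adjc a b ->
  crosses_ray (barycentre3 c d) a b (+) crosses_ray (barycentre3 d c) a b =
  same_pair c d a b (+) (g a (+) g b).
Proof.
wlog fwd_cd : c d / d \in forward c => [flip cd|_].
  case/orP: (cd) => [fwd_cd|fwd_dc]; first exact: flip.
  rewrite adjc_sym in cd; have [g gE] := flip d c fwd_dc cd.
  by exists g => a b ab; rewrite addbC same_pairC gE.
suff [g gE] : exists g : cell -> bool, forall a b, b \in forward a ->
    crosses_ray (barycentre3 c d) a b (+) crosses_ray (barycentre3 d c) a b =
    same_pair c d a b (+) (g a (+) g b).
  exists g => a b /orP[/gE //|/gE gE_ba]; rewrite ![crosses_ray _ a b]crosses_ray_sym same_pair_sym.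
  by rewrite [g a (+) g b]addbC.
move: fwd_cd; rewrite !in_cons in_nil orbF => /predU1P[->|/orP d_up].
  by exists (fun a => (a.2 == c.2) && (c.1 < a.1)) => a b; apply: crosses_ray_flip_row.
exists (fun=> false) => a b fwd_ab; rewrite /= addbF.
by apply: crosses_ray_flip_up fwd_ab; case: d_up => /eqP ->; [left|right].
Qed.

End Lattice.

Section LatticeWalks.
Implicit Types (a b c d t : cell) (X : cell -> cell -> bool) (s : seq cell).

Fixpoint path_parity (f : cell -> cell -> bool) a s : bool :=
  if s is b :: s' then f a b (+) path_parity f b s' else false.

Lemma eq_path_parity (r : rel cell) f g a s :
  (forall b c, r b c -> f b c = g b c) -> path r a s -> path_parity f a s = path_parity g a s.
Proof. by move=> fg; elim: s a => //= b s IH a /andP[/fg -> /IH ->]. Qed.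

Lemma path_parityD f g a s :
  path_parity (fun b c => f b c (+) g b c) a s = path_parity f a s (+) path_parity g a s.
Proof. by elim: s a => //= b s IH a; rewrite IH addbACA. Qed.

Lemma path_parity_telescope (g : cell -> bool) a s :
  path_parity (fun b c => g b (+) g c) a s = g a (+) g (last a s).
Proof.
elim: s a => [|b s IH] a /=; first by rewrite addbb.
by rewrite IH -addbA addKb.
Qed.

Lemma path_parity_notin c d a s : c \notin a :: s -> path_parity (same_pair c d) a s = false.
Proof.
elim: s a => //= b s IH a; rewrite inE negb_or => /andP[ca cbs].
rewrite IH // addbF /same_pair [a == c]eq_sym (negPf ca) /=.
by move: cbs; rewrite inE negb_or [b == c]eq_sym => /andP[/negPf -> _]; rewrite andbF.
Qed.

(* [X c d] tells on which side of a closed walk the triangle left of [(c, d)] lies. *)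
Definition triangle_function X : Prop := forall c d, adjc c d -> X c d = X d (left c d).

Definition bounded_by_walk X a s : Prop :=
  forall c d, adjc c d -> X c d (+) X d c = path_parity (same_pair c d) a s.

Lemma closed_walk_bounds a s : path adjc a s -> last a s = a ->
  exists2 X, triangle_function X & bounded_by_walk X a s.
Proof.
move=> adj_s closed; exists (fun c d => path_parity (crosses_ray (barycentre3 c d)) a s).
  by move=> c d _; rewrite barycentre3_left.
move=> c d cd; have [g gE] := crosses_ray_flip cd.
rewrite -path_parityD (eq_path_parity gE adj_s) path_parityD.
by rewrite path_parity_telescope closed addbb addbF.
Qed.

Lemma bounded_by_walk_flip X a s c d : bounded_by_walk X a s -> c \notin a :: s ->
  adjc c d -> X c d = X d c.
Proof. by move=> bX cs cd; apply/eqP; rewrite -negb_add bX // path_parity_notin. Qed.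

Lemma bounded_by_walk_around X a s c d d' : triangle_function X -> bounded_by_walk X a s ->
  c \notin a :: s -> adjc c d -> adjc c d' -> X c d = X c d'.
Proof.
move=> tX bX cs.
have step b : adjc c b -> X c (left c b) = X c b.
  move=> cb; have /andP[c_left b_left] := adjc_left cb.
  by rewrite (tX c b) // (tX b _) // left_rot (bounded_by_walk_flip bX).
have adj_iter n : adjc c (iter n (left c) (c.1 + 1, c.2)).
  elim: n => [|n IH] /=; last by case/andP: (adjc_left IH).
  by rewrite /adjc !inE eqxx.
suff const b : adjc c b -> X c b = X c (c.1 + 1, c.2) by move=> /const -> /const ->.
by case/adjc_rotations => n ->; elim: n => //= n <-; apply: step.
Qed.

Definition cell_connected (A : cell -> Prop) : Prop :=
  forall P : cell -> Prop, (forall a b, A a -> A b -> adjc a b -> P a -> P b) ->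
  forall a b, A a -> A b -> P a -> P b.

Lemma cell_connected_path (A : cell -> Prop) a b : cell_connected A -> A a -> A b ->
  exists s, [/\ path adjc a s, last a s = b & forall c, c \in a :: s -> A c].
Proof.
move=> cA Aa Ab.
apply: (cA (fun b => exists s, [/\ path adjc a s, last a s = b & forall c, c \in a :: s -> A c])
  _ a b) => //.
  move=> c d Ac Ad cd [s [adj_s last_s sA]]; exists (rcons s d); split.
  - by rewrite rcons_path adj_s last_s.
  - by rewrite last_rcons.
  - by move=> x; rewrite -rcons_cons mem_rcons inE => /predU1P[->|/sA].
by exists [::]; split => // c; rewrite inE => /eqP ->.
Qed.

End LatticeWalks.

(** * Interfaces between labelled regions *)

Section Interface.
Variables (W : eqType) (l : cell -> W) (u v : W).
Hypothesis uv : u != v.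
Implicit Types (p q : cell * cell) (X : cell -> cell -> bool).

Definition on_interface p := [&& adjc p.1 p.2, l p.1 == u & l p.2 == v].

Definition third_label p := l (left p.1 p.2) \notin [:: u; v].

Definition third_cell a :=
  [/\ exists2 b, adjc a b & l b = u, exists2 b, adjc a b & l b = v, l a != u & l a != v].

Lemma third_cell_left p : on_interface p -> third_label p -> third_cell (left p.1 p.2).
Proof.
case: p => c d; rewrite /on_interface /third_label !inE negb_or /=.
case/and3P=> cd /eqP lc /eqP ld /andP[left_u left_v]; have /andP[c_left d_left] := adjc_left cd.
by split => //; [exists c|exists d]; rewrite // adjc_sym.
Qed.

(* One step along the interface between the labels [u] and [v], with [u] on the right. *)
Definition advance p : cell * cell :=
  if l (left p.1 p.2) == u then (left p.1 p.2, p.2) else (p.1, left p.1 p.2).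

Definition retreat p : cell * cell :=
  if l (left p.2 p.1) == u then (left p.2 p.1, p.2) else (p.1, left p.2 p.1).

Lemma on_interface_advance p : on_interface p -> ~~ third_label p -> on_interface (advance p).
Proof.
case: p => c d; rewrite /on_interface /third_label /advance !inE negbK /=.
case/and3P=> cd lc ld; have /andP[c_left d_left] := adjc_left cd.
by case: ifPn => [lu _|_ /= lv] /=; rewrite ?lu ?lv ?lc ?ld ?c_left // adjc_sym d_left.
Qed.

Lemma retreat_advance p : on_interface p -> ~~ third_label p -> retreat (advance p) = p.
Proof.
case: p => c d; rewrite /on_interface /retreat /advance /= => /and3P[_ lc /eqP ld] _.
case: (l (left c d) == u) => /=; first by rewrite left_rot lc.
by rewrite left_rotr ld eq_sym (negPf uv).
Qed.

Definition transparent X p := forall c d, on_interface (c, d) -> (c, d) != p -> X c d = X d c.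

Lemma triangle_function_advance X p : triangle_function X -> on_interface p ->
  X (advance p).2 (advance p).1 = X p.1 p.2.
Proof.
case: p => c d tX /and3P[/= cd _ _]; have /andP[c_left d_left] := adjc_left cd.
rewrite /advance /=; case: ifP => _ /=; first by rewrite -tX.
by rewrite (tX c d) // (tX d _) // left_rot.
Qed.

Lemma advance_iter_returns p (pairs : seq (cell * cell)) :
  (forall q, on_interface q -> q \in pairs) -> (forall n, on_interface (iter n advance p)) ->
  (forall n, ~~ third_label (iter n advance p)) -> exists n, iter n.+1 advance p = p.
Proof.
move=> finite_pairs on_iter no_third.
have cancel i j : iter (i + j) advance p = iter j advance p -> iter i advance p = p.
  elim: j => [|j IH]; first by rewrite addn0.
  rewrite addnS !iterS => iter_eq; apply: IH.
  by rewrite -[LHS]retreat_advance // iter_eq retreat_advance.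
have /(uniqPn p) [i [j [ij]]] : ~~ uniq [seq iter n advance p | n <- iota 0 (size pairs).+1].
  apply: contraT => /negPn /(@uniq_leq_size _ _ pairs); rewrite size_map size_iota ltnn; apply.
  by move=> q /mapP[n _ ->]; apply: finite_pairs.
rewrite size_map size_iota => jst.
rewrite !(nth_map 0%N) ?size_iota ?nth_iota ?add0n ?(ltn_trans ij) // => iter_eq.
exists (j - i).-1; rewrite prednK ?subn_gt0 //.
by apply: (cancel _ i); rewrite subnK // ltnW.
Qed.

Lemma interface_end p (pairs : seq (cell * cell)) : on_interface p ->
  (forall q, on_interface q -> q \in pairs) ->
  (exists2 q, on_interface q /\ third_label q &
     forall X, triangle_function X -> transparent X p -> X q.1 q.2 = X p.1 p.2)
  \/ (forall X, triangle_function X -> transparent X p -> X p.1 p.2 = X p.2 p.1).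
Proof.
move=> on_p finite_pairs; pose t n := iter n advance p.
pose halts n := third_label (t n) || (t n.+1 == p).
have on_t n : (forall i, (i < n)%N -> ~~ halts i) -> on_interface (t n).
  elim: n => [//|n IH] running; apply: on_interface_advance.
    by apply: IH => i ni; apply: running; apply: ltnW.
  by have := running n (ltnSn n); rewrite negb_or => /andP[].
have ex_halt : exists n, halts n.
  apply: contrapT => no_halt.
  have running n : ~~ halts n by apply/negP => halt_n; apply: no_halt; exists n.
  have [n|n|n tn] := @advance_iter_returns p pairs finite_pairs; first by apply: on_t => i _.
    by have := running n; rewrite negb_or => /andP[].
  by have := running n; rewrite /halts [t n.+1]tn eqxx orbT.
have [n halt_n first_halt] := find_ex_minn ex_halt.
have running i : (i < n)%N -> ~~ halts i by rewrite ltnNge; apply: contra => /first_halt.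
have side_t X k : triangle_function X -> transparent X p -> (k <= n)%N ->
    X (t k).1 (t k).2 = X p.1 p.2.
  move=> tX transX; elim: k => [//|k IH] kn.
  have := running k kn; rewrite negb_or => /andP[_ tk].
  have on_tk i : (i <= n)%N -> on_interface (t i).
    by move=> i_le; apply: on_t => j ji; apply: running; apply: leq_trans ji i_le.
  rewrite transX //; last by rewrite -surjective_pairing; apply: on_tk.
  by rewrite triangle_function_advance ?IH ?on_tk // ltnW.
have on_tn := on_t n running.
have [third_tn|t_returns] := orP halt_n.
  by left; exists (t n) => // X tX transX; apply: side_t.
right=> X tX transX; rewrite -(side_t X n) // -(triangle_function_advance tX on_tn).
by rewrite [advance _](eqP t_returns).
Qed.

End Interface.

Lemma third_cellC (W : eqType) (l : cell -> W) (u v : W) a :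
  third_cell l u v a -> third_cell l v u a.
Proof. by case. Qed.

Section Separation.
Variables (W : eqType) (l : cell -> W) (u v : W) (uv_pairs vu_pairs : seq (cell * cell)).
Hypothesis uv : u != v.
Hypothesis finite_uv : forall p, on_interface l u v p -> p \in uv_pairs.
Hypothesis finite_vu : forall p, on_interface l v u p -> p \in vu_pairs.
Implicit Types (a b c d : cell) (X : cell -> cell -> bool) (A : cell -> Prop).

Definition noncrossing_adj c d := adjc c d && ~~ same_pair u v (l c) (l d).

Lemma path_parity_noncrossing c d a s : same_pair u v (l c) (l d) -> path noncrossing_adj a s ->
  path_parity (same_pair c d) a s = false.
Proof.
move=> cross_cd; elim: s a => //= b s IH a /andP[/andP[_ noncross_ab] /IH ->].
rewrite addbF; apply: contraNF noncross_ab => /orP[]/andP[/eqP -> /eqP ->] //.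
by rewrite same_pair_sym.
Qed.

Lemma crossing_walk_bounds c d s : on_interface l u v (c, d) ->
  path noncrossing_adj d s -> last d s = c -> exists X,
  [/\ triangle_function X, transparent l u v X (c, d), transparent l v u X (d, c),
      X c d != X d c & bounded_by_walk X c (d :: s)].
Proof.
move=> /and3P[/= cd /eqP lc /eqP ld] path_s last_s.
have adj_s : path adjc c (d :: s) by rewrite /= cd; apply: sub_path path_s => a b /andP[].
have [X tX bX] := closed_walk_bounds adj_s last_s.
have parityE a b : same_pair u v (l a) (l b) ->
    path_parity (same_pair a b) c (d :: s) = same_pair a b c d.
  by move=> cross_ab; rewrite /= path_parity_noncrossing ?addbF.
exists X; split => // [a b /and3P[/= ab /eqP la /eqP lb] ne|a b /and3P[/= ab /eqP la /eqP lb] ne|].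
- apply/eqP; rewrite -negb_add bX // parityE; last by rewrite la lb /same_pair !eqxx.
  apply/negP => /orP[]/andP[/eqP ca /eqP db]; first by rewrite ca db eqxx in ne.
  by move: uv; rewrite -la -db ld eqxx.
- apply/eqP; rewrite -negb_add bX // parityE; last by rewrite la lb /same_pair !eqxx orbT.
  apply/negP => /orP[]/andP[/eqP ca /eqP db]; last by rewrite ca db eqxx in ne.
  by move: uv; rewrite -lb -db ld eqxx.
- by rewrite -negb_add negbK bX // parityE ?lc ?ld /same_pair !eqxx.
Qed.

Lemma bounded_by_walk_connected X a s A x y x' y' : triangle_function X ->
  bounded_by_walk X a s -> cell_connected A -> (forall b, A b -> b \notin a :: s) ->
  A x -> A y -> adjc x x' -> adjc y y' -> X x x' = X y y'.
Proof.
move=> tX bX cA avoid_s Ax Ay xx' yy'.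
pose side := X x x'; suff : forall z, adjc y z -> X y z = side by move/(_ y' yy').
apply: (cA (fun b => forall z, adjc b z -> X b z = side) _ x y)
  => // [b c Ab Ac bc sideb z cz|z xz].
  have cb : adjc c b by rewrite adjc_sym.
  rewrite (bounded_by_walk_around tX bX (avoid_s c Ac) cz cb).
  by rewrite (bounded_by_walk_flip bX (avoid_s c Ac) cb) sideb.
exact: bounded_by_walk_around tX bX (avoid_s x Ax) xz xx'.
Qed.

Lemma interface_separated c d : on_interface l u v (c, d) ->
  (forall s, path noncrossing_adj d s -> last d s <> c) \/
  exists x y, [/\ third_cell l u v x, third_cell l u v y &
    forall s A, path noncrossing_adj d s -> last d s = c -> cell_connected A ->
      (forall a, A a -> a \notin d :: s) -> A x -> ~ A y].
Proof.
move=> on_cd; have /and3P[/= cd lc ld] := on_cd.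
have on_dc : on_interface l v u (d, c) by rewrite /on_interface /= adjc_sym cd lc ld.
have vu : v != u by rewrite eq_sym.
have [[p [on_p third_p] side_p]|loop] := interface_end uv on_cd finite_uv; last first.
  left=> s path_s last_s; have [X [tX trans_uv _ /eqP]] := crossing_walk_bounds on_cd path_s last_s.
  by case; apply: loop.
have [[q [on_q third_q] side_q]|loop] := interface_end vu on_dc finite_vu; last first.
  left=> s path_s last_s; have [X [tX _ trans_vu /eqP]] := crossing_walk_bounds on_cd path_s last_s.
  by case; apply/esym; apply: loop.
right; exists (left p.1 p.2), (left q.1 q.2); split; first exact: third_cell_left.
  exact/third_cellC/third_cell_left.
move=> s A path_s last_s cA avoid_s Ap Aq.
have [X [tX trans_uv trans_vu /eqP side_cd bX]] := crossing_walk_bounds on_cd path_s last_s.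
apply: side_cd; rewrite -(side_p X) // -(side_q X) //.
have left_side r : adjc r.1 r.2 -> X r.1 r.2 = X (left r.1 r.2) r.1.
  by move=> adj_r; have /andP[? ?] := adjc_left adj_r; rewrite tX // tX // left_rot.
have adj_left r : adjc r.1 r.2 -> adjc (left r.1 r.2) r.1.
  by move=> /adjc_left /andP[? _]; rewrite adjc_sym.
have [adj_p adj_q] : adjc p.1 p.2 /\ adjc q.1 q.2 by case/and3P: on_p; case/and3P: on_q.
rewrite left_side // [RHS]left_side //.
apply: (bounded_by_walk_connected tX bX cA) => // [a /avoid_s a_s||]; try exact: adj_left.
by rewrite inE negb_or a_s andbT; apply: contraNneq a_s => ->; rewrite -last_s mem_last.
Qed.

End Separation.

(** * Adjacency graphs of lattice partitions *)

Lemma cell_connected_line (A P : cell -> Prop) (f : int -> cell) :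
  (forall a b, A a -> A b -> adjc a b -> P a -> P b) ->
  (forall i, A (f i)) -> (forall i, adjc (f i) (f (i + 1))) -> forall i j, P (f i) -> P (f j).
Proof.
move=> P_closed Af adj_f.
have step i (n : nat) : P (f i) <-> P (f (i + n%:Z)).
  elim: n => [|n IH]; first by rewrite addr0.
  rewrite -addn1 PoszD addrA IH; split; apply: P_closed => //.
  by rewrite adjc_sym.
move=> i j Pi; case: (leP i j) => ij.
  have jE : j = i + `|(j - i)%R|%N%:Z by lia.
  by rewrite jE; apply/(step i).
have iE : i = j + `|(i - j)%R|%N%:Z by lia.
by apply/(step j `|(i - j)%R|%N); rewrite -iE.
Qed.

Lemma adjc_row i j : adjc (i, j) (i + 1, j).
Proof. by rewrite /adjc !inE eqxx. Qed.

Lemma adjc_column i j : adjc (i, j) (i, j + 1).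
Proof. by rewrite /adjc !inE eqxx !orbT. Qed.

Lemma cell_connectedT : cell_connected (fun=> True).
Proof.
move=> P P_closed [i j] [i' j'] _ _ Pij.
apply: (cell_connected_line (f := pair i') P_closed) => [//|k|]; first exact: adjc_column.
by apply: (cell_connected_line (f := pair^~ j) P_closed) Pij => // k; apply: adjc_row.
Qed.

Section Planar.
Variable W : finType.
Implicit Types (S U K : {set W}) (e r : rel W) (l : cell -> W) (x y z u v w : W).

Record region_map S e l : Prop := RegionMap {
  region_connected : forall x, cell_connected (fun c => l c = x);
  region_nonempty : forall x, x \in S <-> exists c, l c = x;
  region_adj : forall x y, e x y <-> x != y /\ exists c d, [/\ adjc c d, l c = x & l d = y];
  region_cofinite : exists z (b : seq cell), forall c, c \notin b -> l c = z }.

Definition planar S e : Prop := exists l, region_map S e l.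

Lemma eq_planar S e S' e' : S = S' -> e =2 e' -> planar S e -> planar S' e'.
Proof.
move=> <- ee' [l [l_conn l_nonempty l_adj l_cofinite]]; exists l; split => // x y.
by rewrite -ee'; apply: l_adj.
Qed.

Lemma planar_sym S e : planar S e -> symmetric e.
Proof.
move=> [l lmap] x y; apply/idP/idP => /(region_adj lmap)[ne [c [d [cd lc ld]]]];
  by apply/(region_adj lmap); split; [rewrite eq_sym|exists d, c; rewrite adjc_sym].
Qed.

Lemma planar_irr S e : planar S e -> irreflexive e.
Proof. by move=> [l lmap] x; apply/negP => /(region_adj lmap)[]; rewrite eqxx. Qed.

Lemma planar_neq S e x y : planar S e -> e x y -> x != y.
Proof. by move=> pl; apply: contraTneq => ->; rewrite (planar_irr pl). Qed.

Lemma planar_meml S e x y : planar S e -> e x y -> x \in S.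
Proof.
by move=> [l lmap] /(region_adj lmap)[_ [c [d [_ lc _]]]]; apply/(region_nonempty lmap); exists c.
Qed.

Lemma planar_memr S e x y : planar S e -> e x y -> y \in S.
Proof. by move=> pl; rewrite (planar_sym pl); apply: planar_meml. Qed.

Section RegionMap.
Variables (S : {set W}) (e : rel W) (l : cell -> W).
Hypothesis lmap : region_map S e l.

Definition lift_rel r : rel cell := fun a b => adjc a b && ((l a == l b) || r (l a) (l b)).

Lemma region_path x c d : l c = x -> l d = x -> forall r, exists t,
  [/\ path (lift_rel r) c t, last c t = d & forall a, a \in c :: t -> l a = x].
Proof.
move=> lc ld r.
have [t [path_t last_t lt]] := cell_connected_path (region_connected lmap (x := x)) lc ld.
exists t; split => //; apply: (sub_in_path (P := [pred a | l a == x])) path_t.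
  by move=> a b /eqP la /eqP lb ab; rewrite /lift_rel ab la lb eqxx.
by apply/allP => a /lt /eqP.
Qed.

Lemma lift_path r x s c d : subrel r e -> path r x s -> l c = x -> l d = last x s ->
  exists t, [/\ path (lift_rel r) c t, last c t = d & forall a, a \in c :: t -> l a \in x :: s].
Proof.
move=> re; elim: s x c => [|y s IH] x c /= path_s lc ld.
  have [t [path_t last_t lt]] := region_path lc ld r.
  by exists t; split => // a /lt ->; rewrite mem_head.
case/andP: path_s => rxy path_s; have /(region_adj lmap)[_ [a [b [ab la lb]]]] := re _ _ rxy.
have [t [path_t last_t lt]] := region_path lc la r.
have [t' [path_t' last_t' lt']] := IH y b path_s lb ld.
exists (t ++ b :: t'); split; last 1 first.
- move=> q; rewrite -cat_cons mem_cat => /orP[/lt ->|/lt' lq]; first exact: mem_head.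
  by rewrite inE lq orbT.
- by rewrite cat_path /= path_t last_t /lift_rel ab la lb rxy orbT.
- by rewrite last_cat.
Qed.

Lemma cell_connected_union r (A : W -> Prop) : subrel r e -> (forall x y, r x y -> A x -> A y) ->
  (forall x y, x \in S -> y \in S -> A x -> A y -> connect r x y) ->
  cell_connected (fun c => A (l c)).
Proof.
move=> re A_closed A_conn P P_closed a b Aa Ab.
have mem_l c : l c \in S by apply/(region_nonempty lmap); exists c.
have /connectP[s path_s last_s] := A_conn _ _ (mem_l a) (mem_l b) Aa Ab.
have [t [path_t <- lt]] := lift_path re path_s erefl last_s.
elim: t a Aa {path_s last_s lt} path_t => //= c t IH a Aa /andP[/andP[ac lac] path_t] Pa.
have Ac : A (l c) by case/orP: lac => [/eqP <-//|/A_closed]; apply.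
by apply: IH => //; apply: P_closed ac Pa.
Qed.

Lemma interface_finite u v : u != v ->
  exists pairs : seq (cell * cell), forall p, on_interface l u v p -> p \in pairs.
Proof.
move=> uv; have [z [b lb]] := region_cofinite lmap.
pose b' := b ++ flatten (map cell_nbrs b).
have mem_nbr a a' : adjc a a' -> a \in b -> (a \in b') && (a' \in b').
  move=> aa' ab; rewrite !mem_cat ab /=; apply/orP; right.
  by apply/flatten_mapP; exists a => //; rewrite mem_cell_nbrs.
exists [seq (c, d) | c <- b', d <- b'] => -[c d] /and3P[/= cd /eqP lc /eqP ld].
have : (c \in b) || (d \in b).
  by apply: contraR uv => /norP[/lb cz /lb dz]; rewrite -lc -ld cz dz.
have dc : adjc d c by rewrite adjc_sym.
by case/orP => [/(mem_nbr _ _ cd)|/(mem_nbr _ _ dc)] /andP[mem_c mem_d]; apply: allpairs_f.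
Qed.

End RegionMap.

Lemma planar_connect S e x y : planar S e -> x \in S -> y \in S -> connect e x y.
Proof.
move=> [l lmap] /(region_nonempty lmap)[c <-] /(region_nonempty lmap)[d <-].
apply: (cell_connectedT (P := fun d => connect e (l c) (l d)) _ (a := c)) => // a b _ _ ab ca.
apply: connect_trans ca _; have [->|ne] := eqVneq (l a) (l b); first exact: connect0.
by apply: connect1; apply/(region_adj lmap); split => //; exists a, b.
Qed.

Definition common_nbrs e u v : {set W} := [set x | e u x && e v x].

Lemma remove_vertices_connect K e x y :
  connect (remove_vertices e K) x y -> x \notin K -> y \notin K.
Proof.
case/connectP; elim/last_ind => [|s z _]; first by move=> _ ->.
by rewrite rcons_path last_rcons => /andP[_ /and3P[_ _ zK]] ->.
Qed.

(* [p] and [q] are the ends of the interface between the regions [u] and [v]: together with the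
   edge [u v], any path [s] closes up to a cycle around which the sides of [u v] are distinct. *)
Lemma planar_interface S e u v : planar S e -> e u v ->
  (~~ connect (remove_edge e u v) v u) \/
  exists p q, [/\ p \in common_nbrs e u v, q \in common_nbrs e u v &
    forall s, path (remove_edge e u v) v s -> last v s = u -> p \notin s -> q \notin s ->
      ~~ connect (remove_vertices e [set x in v :: s]) p q].
Proof.
move=> pl euv; have [l lmap] := pl; have e_sym := planar_sym pl.
have uv := planar_neq pl euv; have vu : v != u by rewrite eq_sym.
have [_ [c [d [cd lc ld]]]] := (region_adj lmap u v).1 euv.
have [uv_pairs fin_uv] := interface_finite lmap uv.
have [vu_pairs fin_vu] := interface_finite lmap vu.
have lift s : path (remove_edge e u v) v s -> last v s = u -> exists t,
    [/\ path (noncrossing_adj l u v) d t, last d t = c & forall a, a \in d :: t -> l a \in v :: s].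
  move=> path_s last_s; have sub_e : subrel (remove_edge e u v) e by move=> x y /andP[].
  have [t [path_t last_t lt]] := lift_path lmap sub_e path_s ld (etrans lc (esym last_s)).
  exists t; split => //; apply: sub_path path_t => a b /andP[ab].
  rewrite /noncrossing_adj ab /= => /orP[/eqP ->|/andP[]//]; rewrite /same_pair.
  by apply/negP => /orP[]/andP[/eqP lbu /eqP lbv]; move: uv; rewrite -lbu lbv eqxx.
have on_cd : on_interface l u v (c, d) by rewrite /on_interface cd lc ld !eqxx.
have [loop|[a [b [third_a third_b sep]]]] := interface_separated uv fin_uv fin_vu on_cd.
  left; apply/negP => /connectP[s path_s last_s].
  by have [t [path_t last_t _]] := lift s path_s (esym last_s); apply: (loop t path_t).
have mem_common (f : cell) : third_cell l u v f -> l f \in common_nbrs e u v.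
  case=> [[g fg lg] [h fh lh] fu fv]; rewrite inE.
  by apply/andP; split; apply/(region_adj lmap); split;
    rewrite 1?eq_sym //; [exists g, f|exists h, f]; rewrite adjc_sym.
right; exists (l a), (l b); split; rewrite ?mem_common // => s path_s last_s la_s lb_s.
apply/negP => conn_ab; have [t [path_t last_t lt]] := lift s path_s last_s.
pose r := remove_vertices e [set x in v :: s].
have r_csym := sym_connect_sym (remove_vertices_sym [set x in v :: s] e_sym).
apply: (sep t (fun f => connect r (l a) (l f)) path_t last_t) => //.
  apply: (cell_connected_union lmap (r := r) (A := connect r (l a)))
    => [x y /andP[]//|x y rxy ax|x y _ _ ax ay].
    exact: connect_trans ax (connect1 rxy).
  by apply: connect_trans ay; rewrite r_csym.
have la_vs : l a \notin [set x in v :: s] by case: third_a => _ _ _ av; rewrite !inE negb_or av.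
by move=> f /remove_vertices_connect/(_ la_vs); rewrite inE; apply: contra => /lt.
Qed.

Lemma planar_chord S e u v w : planar S e -> e u v -> w \in common_nbrs e u v ->
  exists p q, [/\ p \in common_nbrs e u v, q \in common_nbrs e u v &
    forall b, b \in common_nbrs e u v -> b != p -> b != q ->
      ~~ connect (remove_vertices e [set u; v; b]) p q].
Proof.
move=> pl euv w_common; have e_sym := planar_sym pl.
have path_through b : b \in common_nbrs e u v -> path (remove_edge e u v) v [:: b; u].
  rewrite inE => /andP[eub evb]; have ub := planar_neq pl eub; have vb := planar_neq pl evb.
  rewrite /= /remove_edge /same_pair evb [e b u]e_sym eub ![b == _]eq_sym (negPf ub) (negPf vb).
  by rewrite !andbF.
have [/negP bridge|[p [q [p_common q_common sep]]]] := planar_interface pl euv.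
  by case: bridge; apply/connectP; exists [:: w; u]; rewrite ?path_through.
have notin_path b x : x \in common_nbrs e u v -> b != x -> x \notin [:: b; u].
  rewrite !inE negb_or [x == b]eq_sym [x == u]eq_sym => /andP[/(planar_neq pl) ux _] ->.
  by rewrite ux.
exists p, q; split => // b b_common bp bq.
have := sep _ (path_through b b_common) erefl
  (notin_path b p p_common bp) (notin_path b q q_common bq).
rewrite (_ : [set x in _] = [set u; v; b]) //.
by apply/setP => x; rewrite !inE; case: (x == u) (x == v) (x == b) => [] [] [].
Qed.

Lemma planar_common_nbr_cut S e u v : planar S e -> e u v -> (#|common_nbrs e u v| <= 1)%N ->
  ~~ connect (remove_vertices (remove_edge e u v) (common_nbrs e u v)) v u.
Proof.
move=> pl euv common_le1; set C := common_nbrs e u v.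
have sub_rel : subrel (remove_vertices (remove_edge e u v) C) (remove_edge e u v).
  by move=> x y /and3P[].
have [bridge|[p [q [pC qC sep]]]] := planar_interface pl euv.
  by apply: contra bridge; apply: connect_sub => x y /sub_rel; apply: connect1.
apply/negP => /connectP[s path_s last_s].
have pq : p = q by move/card_le1_eqP: common_le1; apply.
have ps : p \notin s.
  apply/negP => /path.splitPr ps; case: ps path_s => s1 s2.
  by rewrite cat_path /= => /and3P[_ /and3P[_ _ /negP]].
have := sep s (sub_path sub_rel path_s) (esym last_s) ps.
by rewrite -pq connect0 => /(_ ps).
Qed.

End Planar.

Section PlanarMinors.
Variable W : finType.
Implicit Types (S U K : {set W}) (e : rel W) (f : W -> W) (x y z u v t : W).

Definition quotient_rel f e : rel W :=
  fun a b => (a != b) && [exists x, exists y, [&& e x y, f x == a & f y == b]].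

Definition fibre_rel f e t : rel W := fun x y => [&& e x y, f x == t & f y == t].

Lemma quotient_relP f e a b : reflect (a != b /\ exists x y, [/\ e x y, f x = a & f y = b])
  (quotient_rel f e a b).
Proof.
apply: (iffP andP) => [[ab /existsP[x /existsP[y /and3P[exy /eqP fx /eqP fy]]]]|].
  by split=> //; exists x, y.
move=> [ab [x [y [exy fx fy]]]]; split=> //; apply/existsP; exists x; apply/existsP; exists y.
by rewrite exy fx fy !eqxx.
Qed.

Lemma fibre_rel_sym f e t : symmetric e -> symmetric (fibre_rel f e t).
Proof. by move=> e_sym x y; rewrite /fibre_rel e_sym [(f x == t) && _]andbC. Qed.

Lemma planar_quotient S e f : planar S e ->
  (forall x y, x \in S -> y \in S -> f x = f y -> connect (fibre_rel f e (f x)) x y) ->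
  planar (f @: S) (quotient_rel f e).
Proof.
move=> [l lmap] f_conn; exists (f \o l); split.
- move=> t; apply: (cell_connected_union lmap (r := fibre_rel f e t) (A := fun x => f x = t)).
  + by move=> x y /and3P[].
  + by move=> x y /and3P[_ _ /eqP].
  + by move=> x y xS yS <- fyx; apply: f_conn.
- move=> t; split=> [/imsetP[x /(region_nonempty lmap)[c lc] ->]|[c <-]].
    by exists c; rewrite /= lc.
  by apply: imset_f; apply/(region_nonempty lmap); exists c.
- move=> a b; split=> [/quotient_relP[ab [x [y [exy fx fy]]]]|].
    have /(region_adj lmap)[_ [c [d [cd lc ld]]]] := exy.
    by split=> //; exists c, d; rewrite /= lc ld.
  move=> [ab [c [d [cd flc fld]]]]; apply/quotient_relP; split=> //.
  exists (l c), (l d); split=> //.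
  apply/(region_adj lmap); split; last by exists c, d.
  by apply: contraNneq ab => lcd; rewrite -flc -fld /= lcd.
- by have [z [b lb]] := region_cofinite lmap; exists (f z), b => c /lb /= ->.
Qed.

Definition contract e z v : rel W := fun x y =>
  [&& x != v, y != v, x != y & [|| e x y, (x == z) && e v y | (y == z) && e x v]].

Lemma planar_contract S e z v : planar S e -> e z v -> planar (S :\ v) (contract e z v).
Proof.
move=> pl ezv; have zv := planar_neq pl ezv; have evz : e v z by rewrite (planar_sym pl).
pose f x := if x == v then z else x.
have fv : f v = z by rewrite /f eqxx.
have fE x : x != v -> f x = x by rewrite /f => /negPf ->.
have f_neq x : f x != v by rewrite /f; case: ifPn.
apply: (eq_planar (S := f @: S) (e := quotient_rel f e)); last first.
- apply: planar_quotient => // x y xS yS.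
  have [->|xv] := eqVneq x v; have [->|yv] := eqVneq y v; rewrite ?fv ?fE ?connect0 //.
  + by move=> <-; apply: connect1; rewrite /fibre_rel evz fv fE // eqxx.
  + by move=> ->; apply: connect1; rewrite /fibre_rel ezv fv fE // eqxx.
  + by move=> ->.
- move=> a b; apply/quotient_relP/and4P => [[ab [x [y [exy fx fy]]]]|[av bv ab eab]].
    rewrite -fx -fy in ab *; rewrite !f_neq; split=> //; move: ab exy; rewrite /f.
    by case: (eqVneq x v) => [->|_]; case: (eqVneq y v) => [->|_];
      rewrite /= ?eqxx // => _ ->; rewrite ?orbT.
  split=> //; case/or3P: eab => [eab|/andP[/eqP az evb]|/andP[/eqP bz eav]].
  + by exists a, b; rewrite !fE.
  + by exists v, b; rewrite fv fE.
  + by exists a, v; rewrite fv fE.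
- apply/setP => x; rewrite !inE; apply/imsetP/andP => [[y yS ->]|[xv xS]].
    by rewrite f_neq /f; case: eqP => // _; rewrite (planar_meml pl ezv).
  by exists x; rewrite ?fE.
Qed.

Lemma planar_retract S e U f : planar S e -> (forall x, x \notin U -> f x = x) ->
  (forall x, x \in U -> x \in S ->
     [/\ f x \notin U, f x \in S & connect (fibre_rel f e (f x)) x (f x)]) ->
  (forall x y, e x y -> f x != f y -> e (f x) (f y)) ->
  planar (S :\: U) (remove_vertices e U).
Proof.
move=> pl f_id f_retr f_adj; have e_sym := planar_sym pl.
have f_fibre x : x \in S -> [/\ f x \notin U, f x \in S & connect (fibre_rel f e (f x)) x (f x)].
  move=> xS; have [xU|xU] := boolP (x \in U); first exact: f_retr.
  by rewrite f_id // xU xS connect0.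
apply: (eq_planar (S := f @: S) (e := quotient_rel f e)); last first.
- apply: planar_quotient => // x y xS yS fxy.
  have [_ _ x_fx] := f_fibre x xS; have [_ _ y_fy] := f_fibre y yS.
  apply: connect_trans x_fx _.
  by rewrite (sym_connect_sym (fibre_rel_sym _ _ e_sym)) fxy.
- move=> a b; apply/quotient_relP/and3P => [[ab [x [y [exy fx fy]]]]|[eab aU bU]].
    have [fxU _ _] := f_fibre x (planar_meml pl exy).
    have [fyU _ _] := f_fibre y (planar_memr pl exy).
    by rewrite -fx -fy fxU fyU f_adj // fx fy.
  by split; [apply: (planar_neq pl eab)|exists a, b; rewrite !f_id].
- apply/setP => x; rewrite inE; apply/imsetP/andP => [[y yS ->]|[xU xS]].
    by have [] := f_fibre y yS.
  by exists x; rewrite ?f_id.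
Qed.

Section RemoveBehindClique.
Variables (S U K : {set W}) (e : rel W).
Hypothesis pl : planar S e.
Hypothesis KS : K \subset S.
Hypothesis K_neq0 : K != set0.
Hypothesis K_clique : {in K &, forall x y, x != y -> e x y}.
Hypothesis UK : [disjoint U & K].
Hypothesis U_nbrs : forall x y, x \in U -> y \notin U -> e x y -> y \in K.

Let r := remove_vertices e (~: U).
Let r_csym : connect_sym r := sym_connect_sym (remove_vertices_sym (~: U) (planar_sym pl)).

Let rE x y : e x y -> x \in U -> y \in U -> r x y.
Proof. by move=> exy xU yU; rewrite /r /remove_vertices exy !inE xU yU. Qed.

Definition attached x t := (t \in K) && [exists y, connect r x y && e y t].

Lemma attached_exists x : x \in U -> x \in S -> exists t, attached x t.
Proof.
move=> xU xS; apply/existsP; apply: contraT => none.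
have [k kK] := set0Pn _ K_neq0.
have closed_x : closed e [pred y | connect r x y].
  apply: (intro_closed (sym_connect_sym (planar_sym pl))) => y y' eyy' xy.
  have yU : y \in U by have := remove_vertices_connect xy; rewrite !inE !negbK; apply.
  have [y'U|y'U] := boolP (y' \in U); first exact: connect_trans xy (connect1 (rE eyy' yU y'U)).
  case/negP: none; apply/existsP; exists y'; rewrite /attached (U_nbrs yU y'U eyy').
  by apply/existsP; exists y; rewrite eyy' andbT.
have := closed_connect closed_x (planar_connect pl xS (subsetP KS _ kK)).
rewrite !inE connect0 => /esym/remove_vertices_connect; rewrite !inE !negbK => /(_ xU) kU.
by have := disjointFr UK kU; rewrite kK.
Qed.

Definition retraction x := if x \in U then odflt x [pick t | attached x t] else x.

Lemma retraction_attached x : x \in U -> x \in S -> attached x (retraction x).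
Proof.
move=> xU xS; rewrite /retraction xU; case: pickP => // none.
by have [t] := attached_exists xU xS; rewrite none.
Qed.

Lemma retraction_constant x y : e x y -> x \in U -> y \in U -> retraction x = retraction y.
Proof.
move=> exy xU yU; have rxy := rE exy xU yU.
have attached_xy : attached x =1 attached y.
  by move=> t; congr (_ && _); apply: eq_existsb => z; rewrite (same_connect1 r_csym rxy).
rewrite /retraction xU yU (eq_pick attached_xy); case: pickP => // none.
by have [t] := attached_exists yU (planar_memr pl exy); rewrite none.
Qed.

Lemma retraction_connect x : x \in U -> x \in S ->
  connect (fibre_rel retraction e (retraction x)) x (retraction x).
Proof.
move=> xU xS; set t := retraction x.
have /andP[tK /existsP[y /andP[xy eyt]]] := retraction_attached xU xS.
have tU : t \notin U by rewrite (disjointFl UK tK).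
have closed_t : closed r [pred z | connect (fibre_rel retraction e t) x z & retraction z == t].
  apply: (intro_closed r_csym) => z z' /and3P[ezz' zU z'U] /andP[xz zt].
  rewrite !inE !negbK in zU z'U.
  have z't : retraction z' == t by rewrite -(retraction_constant ezz' zU z'U).
  by rewrite inE z't andbT; apply: connect_trans xz (connect1 _); rewrite /fibre_rel ezz' zt.
have := closed_connect closed_t xy; rewrite !inE connect0 eqxx => /esym/andP[x_y yt].
apply: connect_trans x_y (connect1 _).
by rewrite /fibre_rel eyt yt /retraction (negPf tU) eqxx.
Qed.

Lemma planar_remove_vertices : planar (S :\: U) (remove_vertices e U).
Proof.
have retr_id x : x \notin U -> retraction x = x by move=> /negPf xU; rewrite /retraction xU.
have retr_K x : x \in U -> x \in S -> retraction x \in K.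
  by move=> xU xS; have /andP[] := retraction_attached xU xS.
have adj_out x y : e x y -> x \in U -> y \notin U -> retraction x != y -> e (retraction x) y.
  move=> exy xU yU; apply: K_clique (retr_K x xU (planar_meml pl exy)) (U_nbrs xU yU exy).
apply: (planar_retract pl retr_id) => [x xU xS|x y exy].
  have xK := retr_K x xU xS.
  by rewrite (disjointFl UK xK) (subsetP KS _ xK) retraction_connect.
have [xU|xU] := boolP (x \in U); have [yU|yU] := boolP (y \in U).
- by rewrite (retraction_constant exy) // eqxx.
- by rewrite (retr_id y) //; apply: adj_out.
- rewrite (retr_id x) // eq_sym (planar_sym pl) => neq; apply: adj_out neq => //.
  by rewrite (planar_sym pl).
- by rewrite !retr_id.
Qed.

End RemoveBehindClique.

Lemma planar_edge_cut S e u v : planar S e -> e u v -> (#|common_nbrs e u v| <= 1)%N ->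
  exists A : {set W}, [/\ u \in A, v \notin A, A \subset S, [disjoint A & common_nbrs e u v] &
    forall x y, e x y -> x \in A -> y \notin A -> y \notin common_nbrs e u v -> x = u /\ y = v].
Proof.
move=> pl euv common_le1; set C := common_nbrs e u v.
pose r := remove_vertices (remove_edge e u v) C.
have e_sym := planar_sym pl.
have r_csym : connect_sym r.
  by apply: sym_connect_sym; apply: remove_vertices_sym; apply: remove_edge_sym.
pose A := [set x | connect r u x].
have uC : u \notin C by rewrite inE (planar_irr pl).
have AC x : x \in A -> x \notin C by rewrite inE => /remove_vertices_connect; apply.
have vA : v \notin A by rewrite inE r_csym (planar_common_nbr_cut pl euv).
exists A; split => //.
- by rewrite inE connect0.
- apply/subsetP => x; rewrite inE r_csym => /connectP[[|y s] /=].
    by move=> _ <-; apply: planar_meml euv.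
  by case/andP => /and3P[/andP[exy _] _ _] _ _; apply: planar_meml exy.
- by apply/pred0P => x; apply/negP => /andP[/= /AC/negP].
move=> x y exy xA yA yC.
have : ~~ r x y.
  by apply: contra yA => rxy; move: xA; rewrite !inE => ux; apply: connect_trans ux (connect1 rxy).
rewrite /r /remove_vertices /remove_edge exy AC // yC !andbT negbK /=.
case/orP=> /andP[/eqP xE /eqP yE] //.
by rewrite xE (negPf vA) in xA.
Qed.

End PlanarMinors.

(** * The induction of Thomassen and Zhu *)

Section CappedMonomials.
Variable W : finType.
Implicit Types (S R Z U K A B : {set W}) (e : rel W) (x y z u v w t : W) (m : {ffun W -> int}).

Definition nbhd e z : {set W} := [set x | e z x].

Definition cap R Z x : int := if x \in R then 0 else if x \in Z then 2 else 4.

Lemma cap_le R Z R' Z' x : (x \in R' -> x \in R) ->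
  (x \in Z' -> (x \in Z) || (x \in R)) -> cap R Z x <= cap R' Z' x.
Proof.
rewrite /cap; case: (x \in R') => [/(_ isT) -> //|_]; case: (x \in R); first by case: ifP.
by rewrite orbF; case: (x \in Z') => [/(_ isT) -> //|_]; case: ifP.
Qed.

Lemma remove_edge_vertices e K u v :
  remove_edge (remove_vertices e K) u v =2 remove_vertices (remove_edge e u v) K.
Proof. by move=> x y; rewrite /remove_edge /remove_vertices andbAC. Qed.

Lemma remove_verticesC e K U :
  remove_vertices (remove_vertices e K) U =2 remove_vertices (remove_vertices e U) K.
Proof.
move=> x y; rewrite /remove_vertices.
by case: (e x y) (x \in K) (y \in K) (x \in U) (y \in U) => [] [] [] [] [].
Qed.

Lemma cap_root0 e m R Z r : monomial e m -> (forall x, m x <= cap R Z x) -> r \in R -> m r = 0.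
Proof.
move=> em m_le rR; apply/le_anti; rewrite (monomial_ge0 r em) andbT.
by have := m_le r; rewrite /cap rR.
Qed.

Definition root_capped e v Z := bounded_monomial e (cap [set v] Z).
Definition edge_capped e u v Z := bounded_monomial (remove_edge e u v) (cap [set u; v] Z).
Definition outer_root_capped e z v := root_capped (remove_vertices e [set z]) v (nbhd e z).
Definition outer_edge_capped e z u v := edge_capped (remove_vertices e [set z]) u v (nbhd e z).

Lemma capped_add_edge e u r Z : symmetric e -> irreflexive e -> e u r ->
  edge_capped e u r Z -> root_capped e r Z.
Proof.
move=> e_sym e_irr eur [m em m_le].
have mr0 : m r = 0 by apply: cap_root0 em m_le _; rewrite set22.
have mu0 : m u = 0 by apply: cap_root0 em m_le _; rewrite set21.
exists (m + delta u); first exact: (monomial_add_edge e_sym e_irr eur).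
have ur : u != r by apply: contraTneq eur => ->; rewrite e_irr.
move=> x; rewrite exponentD ffunE; have := m_le x; rewrite /cap !inE.
have [->|_] /= := eqVneq x u; last by rewrite addr0.
by rewrite mu0 (negPf ur); case: ifP.
Qed.

Record capped S e : Prop := Capped {
  capped_root : forall v, v \in S -> root_capped e v set0;
  capped_edge : forall u v, e u v -> edge_capped e u v set0;
  capped_outer_root : forall z v, e z v -> outer_root_capped e z v;
  capped_outer_edge : forall z u v, e z u -> e z v -> e u v -> outer_edge_capped e z u v }.

Section Step.
Variables (S : {set W}) (e : rel W).
Hypothesis pl : planar S e.
Hypothesis smaller_capped : forall S' e', planar S' e' -> (#|S'| < #|S|)%N -> capped S' e'.

Let e_sym : symmetric e := planar_sym pl.
Let e_irr : irreflexive e := planar_irr pl.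
Let e_neq x y : e x y -> x != y := planar_neq pl.
Let meml x y : e x y -> x \in S := planar_meml pl.
Let memr x y : e x y -> y \in S := planar_memr pl.

Let outer_sym z : symmetric (remove_vertices e [set z]) := remove_vertices_sym [set z] e_sym.
Let outer_irr z : irreflexive (remove_vertices e [set z]) := remove_vertices_irr [set z] e_irr.

Lemma capped_remove U K w : w \in U -> w \in S -> K \subset S -> K != set0 ->
  {in K &, forall x y, x != y -> e x y} -> [disjoint U & K] ->
  (forall x y, x \in U -> y \notin U -> e x y -> y \in K) ->
  capped (S :\: U) (remove_vertices e U).
Proof.
move=> wU wS KS K_neq0 K_clique UK U_nbrs.
apply: smaller_capped; first exact: planar_remove_vertices U_nbrs.
apply: proper_card; apply/properP; split; first exact: subsetDl.
by exists w => //; rewrite inE wU.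
Qed.

Lemma capped_remove_behind_vertex U k w : w \in U -> w \in S -> k \in S -> k \notin U ->
  (forall x y, x \in U -> y \notin U -> e x y -> y = k) ->
  capped (S :\: U) (remove_vertices e U).
Proof.
move=> wU wS kS kU U_nbrs; apply: (capped_remove (K := [set k]) wU wS).
- by rewrite sub1set.
- by apply/set0Pn; exists k; rewrite set11.
- by move=> x y /set1P -> /set1P ->; rewrite eqxx.
- by rewrite disjoint_sym disjoints1.
- by move=> x y xU yU exy; rewrite (U_nbrs x y) // set11.
Qed.

Lemma capped_remove_behind_edge U k k' w : w \in U -> w \in S -> e k k' ->
  k \notin U -> k' \notin U ->
  (forall x y, x \in U -> y \notin U -> e x y -> y = k \/ y = k') ->
  capped (S :\: U) (remove_vertices e U).
Proof.
move=> wU wS ekk' kU k'U U_nbrs; apply: (capped_remove (K := [set k; k']) wU wS).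
- by rewrite subUset !sub1set (meml ekk') (memr ekk').
- by apply/set0Pn; exists k; rewrite set21.
- by move=> x y /set2P[] -> /set2P[] ->; rewrite ?eqxx // e_sym.
- by rewrite disjoint_sym disjoints_subset subUset !sub1set !inE kU k'U.
- by move=> x y xU yU exy; rewrite !inE; case: (U_nbrs x y) => // ->; rewrite eqxx ?orbT.
Qed.

Lemma bridge_split u v : e u v -> common_nbrs e u v = set0 -> exists A : {set W},
  [/\ u \in A, v \notin A, A \subset S,
      capped (S :\: (S :\: A)) (remove_vertices e (S :\: A)) /\
      capped (S :\: A) (remove_vertices e A) &
      forall x y, remove_edge e u v x y -> (x \in A) = (y \in A)].
Proof.
move=> euv no_common.
have [|A [uA vA AS _ A_cut]] := planar_edge_cut pl euv; first by rewrite no_common cards0.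
have {}A_cut x y : e x y -> x \in A -> y \notin A -> x = u /\ y = v.
  by move=> exy xA yA; apply: A_cut; rewrite // no_common inE.
have [uS vS] := (meml euv, memr euv).
exists A; split=> //; last first.
  move=> x y /andP[exy]; apply: contraNeq; have eyx : e y x by rewrite e_sym.
  case: (boolP (x \in A)) => xA; case: (boolP (y \in A)) => yA // _.
    by have [-> ->] := A_cut x y exy xA yA; rewrite /same_pair !eqxx.
  by have [-> ->] := A_cut y x eyx yA xA; rewrite /same_pair !eqxx orbT.
split.
  apply: (@capped_remove_behind_vertex _ u v) => //; rewrite ?inE ?uA ?vA //.
  move=> x y; rewrite !inE => /andP[xA _] + exy; rewrite (memr exy) andbT negbK => yA.
  by rewrite e_sym in exy; have [] := A_cut _ _ exy yA xA.
apply: (@capped_remove_behind_vertex _ v u) => // x y xA yA exy.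
by have [] := A_cut x y exy xA yA.
Qed.

Lemma root_step : (forall u v, e u v -> edge_capped e u v set0) ->
  forall v, v \in S -> root_capped e v set0.
Proof.
move=> edge_cap v vS; have [w evw|isolated] := pickP (e v).
  have ewv : e w v by rewrite e_sym.
  exact: capped_add_edge (edge_cap w v ewv).
exists 0; last by move=> x; rewrite exponent0 /cap; do 2?case: ifP.
apply: monomial_edgeless => x y; apply/negP => exy.
have /connectP[[|w s] /=] := planar_connect pl vS (meml exy).
  by move=> _ xv; rewrite xv isolated in exy.
by rewrite isolated.
Qed.

Lemma edge_step_common u v w : e w u -> e w v -> e u v -> outer_edge_capped e w u v ->
  edge_capped e u v set0.
Proof.
move=> ewu ewv euv [m em m_le]; have mu0 : m u = 0 by apply: cap_root0 em m_le _; rewrite set21.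
have [wu wv] := (e_neq ewu, e_neq ewv).
apply: bounded_monomial_le (bounded_monomial_add_rooted_vertex (v := w) (r := u) v
  (remove_edge_sym u v e_sym) (remove_edge_irr u v e_irr) _ _ mu0).
- move=> x; have := m_le x; rewrite /cap !inE /remove_edge /same_pair.
  have [->|xw] := eqVneq x w; first by rewrite (negPf wu) (negPf wv).
  by case: (x == u); case: (x == v); case: (e w x) => /=; rewrite ?andbF ?andbT; lia.
- by rewrite /remove_edge /same_pair ewu (negPf wu) (negPf wv).
- exact: eq_monomial (remove_edge_vertices _ _ _ _) em.
Qed.

Lemma edge_step_bridge u v : e u v -> common_nbrs e u v = set0 -> edge_capped e u v set0.
Proof.
move=> euv no_common; have [A [uA vA AS [capA capB] same_side]] := bridge_split euv no_common.
set B := S :\: A in capA capB; have [uS vS] := (meml euv, memr euv).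
have memB x : x \in S -> (x \in B) = (x \notin A) by move=> xS; rewrite inE xS andbT.
have pairF x y : same_pair u v x y -> (x \in A) != (y \in A).
  by case/orP=> /andP[/eqP-> /eqP->]; rewrite uA (negPf vA).
apply: (bounded_monomial_glue (U := B) (b := cap [set u] set0) (b' := cap [set v] set0)).
- apply: eq_bounded_monomial (capped_root capA _); last by rewrite inE uS memB // uA.
  move=> x y; rewrite /remove_vertices /remove_edge; case: (boolP (e x y)) => //= exy.
  rewrite !memB ?(meml exy) ?(memr exy) // !negbK.
  have := pairF x y; case: same_pair => //= /(_ isT).
  by case: (x \in A); case: (y \in A).
- apply: eq_bounded_monomial (capped_root capB _); last by rewrite memB.
  move=> x y; rewrite /edges_at; have := same_side x y; rewrite /remove_vertices /remove_edge.
  case: (boolP (e x y)) => //= exy; rewrite !memB ?(meml exy) ?(memr exy) //.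
  have := pairF x y; case: same_pair => /= [/(_ isT) + _|_ /(_ isT) ->]; last by rewrite orbb andbb.
  by case: (x \in A); case: (y \in A).
- move=> x y exy xB yB; have /andP[exy' _] := exy; have := same_side x y exy.
  by move: xB yB; rewrite !memB ?(meml exy') ?(memr exy') // negbK => -> /negPf ->.
- move=> x; case: ifP => xB; apply: cap_le; rewrite !inE // => /orP[] /eqP xE; rewrite xE ?eqxx //.
    by rewrite xE memB // uA in xB.
  by rewrite xE memB // vA in xB.
Qed.

Lemma outer_root_step_pendant z v : e z v -> (forall x, e z x -> x = v) -> outer_root_capped e z v.
Proof.
move=> ezv only_v; have [zS vS] := (meml ezv, memr ezv); have zv := e_neq ezv.
have [||||x y /set1P -> _ /only_v //|capz _ _ _] := @capped_remove_behind_vertex [set z] v z;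
  rewrite ?inE // 1?eq_sym //.
apply: bounded_monomial_le (capz v _); last by rewrite !inE eq_sym zv.
by move=> x; apply: cap_le => //; rewrite !inE => /only_v ->; rewrite eqxx.
Qed.

Lemma outer_root_step_common z v b : e z v -> e z b -> e b v ->
  outer_edge_capped e z b v -> outer_root_capped e z v.
Proof.
move=> ezv ezb ebv; apply: capped_add_edge => //.
by rewrite /remove_vertices ebv !inE ![_ == z]eq_sym (e_neq ezb) (e_neq ezv).
Qed.

Lemma outer_root_step_bridge z v v' : e z v -> e z v' -> v' != v -> common_nbrs e z v = set0 ->
  outer_root_capped e z v.
Proof.
move=> ezv ezv' v'v no_common.
have [A [zA vA AS [capA capB] same_side]] := bridge_split ezv no_common.
set B := S :\: A in capA capB; have [vS zS] := (memr ezv, meml ezv).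
have memB x : x \in S -> (x \in B) = (x \notin A) by move=> xS; rewrite inE xS andbT.
have mem_A x : e z x -> x != v -> x \in A.
  move=> ezx xv; rewrite -(same_side z) // /remove_edge /same_pair ezx (negPf xv) eqxx.
  by rewrite (negPf (e_neq ezv)).
have same_side_outer x y : remove_vertices e [set z] x y -> (x \in A) = (y \in A).
  case/and3P; rewrite !inE => exy xz yz; apply: same_side.
  by rewrite /remove_edge exy /same_pair (negPf xz) (negPf yz) andbF.
apply: (bounded_monomial_glue (U := A) (b := cap [set v] set0)
  (b' := cap [set v'] (nbhd (remove_vertices e B) z))).
- apply: eq_bounded_monomial (capped_root capB _); last by rewrite memB.
  have notin_A x : x \notin A -> (x \notin [set z]) by rewrite inE; apply: contraNneq => ->.
  move=> x y; rewrite /remove_vertices.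
  case: (boolP (x \in A)) => [|/notin_A ->]; rewrite /= ?andbF //.
  by case: (boolP (y \in A)) => [|/notin_A ->]; rewrite /= ?andbF ?andbT.
- apply: eq_bounded_monomial (capped_outer_root capA (z := z) (v := v') _); last first.
    by rewrite /remove_vertices ezv' !memB ?(memr ezv') // zA mem_A.
  move=> x y; rewrite remove_verticesC /edges_at {1}/remove_vertices.
  have [outer_xy|//] := boolP (remove_vertices e [set z] x y).
  have /andP[exy _] := outer_xy; rewrite !memB ?(meml exy) ?(memr exy) // !negbK.
  by rewrite (same_side_outer x y) // orbb andbb.
- by move=> x y /same_side_outer xyA xA yA; rewrite xyA yA in xA.
- move=> x; case: ifPn => xA; apply: cap_le; rewrite !inE //.
  + by move/eqP=> xv; rewrite xv (negPf vA) in xA.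
  + by move=> ezx; rewrite /remove_vertices ezx !memB ?(memr ezx) // zA xA.
  + by move=> ezx; apply/orP; right; apply: contraNT xA; apply: mem_A.
Qed.

Lemma disconnected_avoids_edge K p q v1 v2 : e v1 v2 -> p \notin K -> q \notin K ->
  ~~ connect (remove_vertices e K) p q ->
  exists2 t, (t == p) || (t == q) &
    forall v, v \in [set v1; v2] -> ~~ connect (remove_vertices e K) t v.
Proof.
move=> e12 pK qK npq; set r := remove_vertices e K.
have r_sym : symmetric r := remove_vertices_sym K e_sym.
have r_csym := sym_connect_sym r_sym.
have [hits_p|none] := boolP [exists v in [set v1; v2], connect r p v]; last first.
  exists p; rewrite ?eqxx // => v v12; apply: contra none => pv.
  by apply/existsP; exists v; rewrite v12.
exists q; rewrite ?eqxx ?orbT // => v v12; apply: contra npq => qv.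
have /existsP[w /andP[w12 pw]] := hits_p.
have vK := remove_vertices_connect qv qK; have wK := remove_vertices_connect pw pK.
apply: connect_trans pw _; rewrite r_csym; apply: connect_trans qv _.
have [->|vw] := eqVneq v w; first exact: connect0.
apply: connect1; rewrite /r /remove_vertices vK wK !andbT.
by move: v12 w12 vw => /set2P[] -> /set2P[] ->; rewrite ?eqxx // e_sym.
Qed.

Section TriangleSeparation.
Variables (z v b : W) (U : {set W}).
Let K : {set W} := [set z; v; b].
Let V : {set W} := S :\: (K :|: U).
Hypotheses (ezv : e z v) (ezb : e z b) (evb : e v b) (UK : [disjoint U & K]).
Hypothesis U_nbrs : forall x y, x \in U -> y \notin U -> e x y -> y \in K.

Let KP x : x \in K -> [\/ x = z, x = v | x = b].
Proof. by rewrite !inE => /orP[/orP[]|] /eqP ->; constructor. Qed.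

Let notin_UK x : x \in K -> x \notin U.
Proof. by move=> xK; rewrite (disjointFl UK xK). Qed.

Let notin_VK x : x \in K -> x \notin V.
Proof. by move=> xK; rewrite inE inE xK. Qed.

Let notin_VU x : x \in U -> x \notin V.
Proof. by move=> xU; rewrite in_setD in_setU xU orbT. Qed.

Let memV x : x \in S -> (x \in V) = (x \notin K) && (x \notin U).
Proof. by move=> xS; rewrite in_setD in_setU xS andbT negb_or. Qed.

Lemma capped_triangle_sides s t : t \in U -> t \in S -> s \in V ->
  capped (S :\: U) (remove_vertices e U) /\ capped (S :\: V) (remove_vertices e V).
Proof.
move=> tU tS sV; have sS : s \in S by move: sV; rewrite inE => /andP[].
have KS : K \subset S.
  by apply/subsetP => x /KP[] ->; [apply: meml ezv|apply: memr ezv|apply: memr ezb].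
have K_neq0 : K != set0 by apply/set0Pn; exists z; rewrite !inE eqxx.
have K_clique : {in K &, forall x y, x != y -> e x y}.
  by move=> x y /KP[] -> /KP[] ->; rewrite ?eqxx // e_sym.
split; first exact: (capped_remove tU tS KS K_neq0 K_clique UK U_nbrs).
apply: (capped_remove sV sS KS K_neq0 K_clique) => [|x y xV yV exy].
  by rewrite disjoint_sym disjoints_subset; apply/subsetP => x /notin_VK; rewrite in_setC.
move: xV yV; rewrite !memV ?(meml exy) ?(memr exy) // => /andP[xK xU].
apply: contraR => yK; rewrite yK /=; apply: contra xU => yU.
by apply: contraR xK => xU; apply: U_nbrs yU xU _; rewrite e_sym.
Qed.

Lemma edges_at_triangle_side v1 v2 : v1 \notin U -> v2 \notin U ->
  remove_edge (remove_vertices (remove_vertices e V) [set z]) v b =2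
  edges_at (remove_edge (remove_vertices e [set z]) v1 v2) U.
Proof.
move=> v1U v2U x y; have [exy|nexy] := boolP (e x y); last first.
  by rewrite /edges_at /remove_edge /remove_vertices (negPf nexy).
have [xyU|] := boolP ((x \in U) || (y \in U)).
  wlog xU : x y exy {xyU} / x \in U => [at_U|].
    case/orP: xyU => [xU|yU]; first exact: at_U.
    have outer_sym' A a a' :
        symmetric (remove_edge (remove_vertices (remove_vertices e A) [set z]) a a').
      by apply/remove_edge_sym/remove_vertices_sym/remove_vertices_sym.
    rewrite outer_sym' at_U 1?e_sym // /edges_at orbC remove_edge_sym //.
  have yV : y \notin V.
    have [/notin_VU//|yU] := boolP (y \in U); exact: notin_VK (U_nbrs xU yU exy).
  have [zK vK bK] : [/\ z \in K, v \in K & b \in K] by rewrite !inE !eqxx !orbT.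
  have x_neq w : w \notin U -> (x == w) = false by apply: contraNF => /eqP <-.
  rewrite /edges_at /remove_edge /remove_vertices /same_pair exy xU (negPf yV) notin_VU //.
  by rewrite !in_set1 !x_neq // ?notin_UK //= ?andbT.
rewrite negb_or => /andP[xU yU]; rewrite /edges_at (negPf xU) (negPf yU) andbF.
apply/negbTE; rewrite /remove_edge /remove_vertices exy !memV ?(meml exy) ?(memr exy) // xU yU.
rewrite /= !andbT !negbK !in_set1 -!andbA; apply/negP => /and5P[xK yK xz yz].
have := e_neq exy; case: (KP xK) (KP yK) xz yz => -> [] ->;
  by rewrite ?eqxx // /same_pair ?eqxx ?orbT.
Qed.

Lemma outer_edge_glue v1 v2 : v1 \notin U -> v2 \notin U ->
  outer_edge_capped (remove_vertices e U) z v1 v2 ->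
  outer_edge_capped (remove_vertices e V) z v b -> outer_edge_capped e z v1 v2.
Proof.
move=> v1U v2U boundU boundV; have zK : z \in K by rewrite !inE eqxx.
apply: (bounded_monomial_glue (U := U) _ _).
- apply: eq_bounded_monomial boundU => x y; rewrite -remove_edge_vertices /remove_edge.
  by rewrite remove_verticesC.
- exact: eq_bounded_monomial (edges_at_triangle_side v1U v2U) boundV.
- move=> x y /andP[/and3P[exy xz _] _] xU yU; rewrite /cap.
  have /KP : x \in K by apply: U_nbrs yU xU _; rewrite e_sym.
  by case=> xE; rewrite xE !inE ?eqxx ?orbT // in xz *.
- move=> x; case: ifPn => xU; apply: cap_le; rewrite !in_set2 /nbhd ?inE //.
  + by case/orP=> /eqP xE; rewrite xE ?(negPf v1U) ?(negPf v2U) in xU.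
  + by move=> ezx; rewrite /remove_vertices ezx notin_VK ?notin_VU.
  + by move=> ezx; rewrite /remove_vertices ezx xU notin_UK.
Qed.

End TriangleSeparation.

Lemma outer_edge_step_chord z v1 v2 v b p q : e z v1 -> e z v2 -> e v1 v2 ->
  e z v -> e z b -> e v b -> p \in S -> q \in S ->
  p \notin [set z; v; b] -> q \notin [set z; v; b] ->
  ~~ connect (remove_vertices e [set z; v; b]) p q ->
  outer_edge_capped e z v1 v2.
Proof.
move=> ez1 ez2 e12 ezv ezb evb pS qS; set K := [set z; v; b] => pK qK npq.
have r_csym := sym_connect_sym (remove_vertices_sym K e_sym).
have [t t_pq t_avoids] := disconnected_avoids_edge e12 pK qK npq.
have [tS tK] : t \in S /\ t \notin K by case/orP: t_pq => /eqP ->.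
have [s [sS sK nts]] : exists s, [/\ s \in S, s \notin K & ~~ connect (remove_vertices e K) t s].
  case/orP: t_pq => /eqP ->; first by exists q.
  by exists p; split; rewrite // r_csym.
pose U := [set x | connect (remove_vertices e K) t x].
have notinK x : x \in U -> x \notin K by rewrite inE => /remove_vertices_connect; apply.
have UK : [disjoint U & K] by rewrite disjoints_subset; apply/subsetP => x /notinK; rewrite in_setC.
have U_nbrs x y : x \in U -> y \notin U -> e x y -> y \in K.
  move=> xU yU exy; apply: contraR yU => yK; have xK := notinK x xU.
  move: xU; rewrite !inE => tx; apply: connect_trans tx (connect1 _).
  by rewrite /remove_vertices exy xK.
have tU : t \in U by rewrite inE connect0.
have sV : s \in S :\: (K :|: U) by rewrite in_setD in_setU sS (negPf sK) inE nts.
have [v1U v2U] : v1 \notin U /\ v2 \notin U by rewrite !inE !t_avoids ?set21 ?set22.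
have [capU capV] := capped_triangle_sides ezv ezb evb UK U_nbrs tU tS sV.
have [zK vK bK] : [/\ z \in K, v \in K & b \in K] by rewrite !inE !eqxx !orbT.
have notinU x : x \in K -> x \notin U by move=> xK; rewrite (disjointFl UK xK).
have notinV x : x \in K -> x \notin S :\: (K :|: U) by move=> xK; rewrite in_setD in_setU xK.
apply: (outer_edge_glue UK U_nbrs v1U v2U).
  by apply: (capped_outer_edge capU); rewrite /remove_vertices ?ez1 ?ez2 ?e12 ?v1U ?v2U ?notinU.
by apply: (capped_outer_edge capV); rewrite /remove_vertices ?ezv ?ezb ?evb !notinV.
Qed.

Lemma outer_edge_step_contract z v1 v2 v w : e z v1 -> e z v2 -> e v1 v2 ->
  e z v -> e v1 v -> v != v2 -> (forall x, e z x -> e v x -> x = v1 \/ x = w) ->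
  outer_edge_capped e z v1 v2.
Proof.
move=> ez1 ez2 e12 ezv e1v vv2 common; pose e0 := remove_edge (remove_vertices e [set z]) v1 v2.
have e0_sym : symmetric e0 by apply/remove_edge_sym/outer_sym.
have e0_irr : irreflexive e0 by apply/remove_edge_irr/outer_irr.
have [zv1 zv2 zv v1v] := And4 (e_neq ez1) (e_neq ez2) (e_neq ezv) (e_neq e1v).
have card_lt : (#|S :\ v| < #|S|)%N by rewrite [X in (_ < X)%N](cardsD1 v) (memr ezv).
have contract_z x : x != v -> contract e z v z x = (z != x) && (e z x || e v x).
  by move=> xv; rewrite /contract xv zv eqxx; case: eqVneq => //= _; rewrite orbF.
have [|||m em m_le] := capped_outer_edge (smaller_capped (planar_contract pl ezv) card_lt)
    (z := z) (u := v1) (v := v2).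
- by rewrite contract_z // zv1 ez1.
- by rewrite contract_z ?zv2 ?ez2 // eq_sym.
- by rewrite /contract v1v eq_sym vv2 (e_neq e12) e12.
have m10 : m v1 = 0 by apply: cap_root0 em m_le _; rewrite set21.
have {}em : monomial (remove_vertices e0 [set v]) m.
  apply: eq_monomial em => x y; rewrite -remove_edge_vertices /remove_edge; congr (_ && _).
  rewrite /remove_vertices /contract !in_set1.
  have [->|xz] := eqVneq x z; first by rewrite !andbF.
  have [->|yz] := eqVneq y z; first by rewrite !andbF.
  have [->|xy] := eqVneq x y; first by rewrite e_irr !andbF.
  by rewrite /= orbF !andbT; case: (e x y); rewrite ?andbF ?andbT.
have e0v x : e0 v x = e v x && (x != z).
  rewrite /e0 /remove_edge /remove_vertices /same_pair !in_set1 [v == z]eq_sym zv.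
  by rewrite [v == v1]eq_sym (negPf v1v) (negPf vv2) andbT.
apply: bounded_monomial_le
  (bounded_monomial_add_rooted_vertex (v := v) (r := v1) w e0_sym e0_irr _ em m10); last first.
  by rewrite e0v e_sym e1v eq_sym zv1.
move=> x; have := m_le x; rewrite /cap !in_set2 !inE e0v.
case: (eqVneq x v) => [->|xv].
  by rewrite [v == v1]eq_sym (negPf v1v) (negPf vv2) ezv.
rewrite contract_z //; case: (eqVneq x v1) => [_|x1]; first by rewrite /= andbF addr0.
case: (eqVneq x z) => [->|xz]; first by rewrite /= e_irr andbF addr0.
rewrite /= andbT; case: (boolP (e z x)) => [ezx|nezx] /=; last first.
  rewrite (_ : (x == v2) = false); last by apply: contraNF nezx => /eqP ->.
  by clear; case: (e v x); case: (x == w) => /=; lia.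
case: (boolP (e v x)) => [evx|_]; last by rewrite addr0.
by case: (common x ezx evx) => xE; [rewrite xE eqxx in x1|rewrite xE eqxx addr0].
Qed.

Section OuterCut.
Variables (z v1 v2 : W) (A : {set W}).
Let B : {set W} := S :\: (v2 |: A).
Hypotheses (ez1 : e z v1) (ez2 : e z v2) (e12 : e v1 v2).
Hypotheses (v1A : v1 \in A) (v2A : v2 \notin A) (zA : z \notin A).
Hypothesis A_cut : forall x y, e x y -> x \in A -> y \notin A -> y != v2 -> x = v1 /\ y = z.

Let memB x : x \in S -> (x \in B) = (x != v2) && (x \notin A).
Proof. by move=> xS; rewrite in_setD in_setU1 xS andbT negb_or. Qed.

Let zB : z \in B. Proof. by rewrite memB ?(meml ez1) // zA (e_neq ez2). Qed.
Let v1B : v1 \notin B. Proof. by rewrite memB ?(memr ez1) // v1A andbF. Qed.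
Let v2B : v2 \notin B. Proof. by rewrite memB ?(memr ez2) // eqxx. Qed.

Let B_nbrs x y : x \in B -> y \notin B -> e x y -> y = v2 \/ x = z /\ y = v1.
Proof.
move=> xB yB exy; have [->|y2] := eqVneq y v2; [by left|right].
move: xB yB; rewrite !memB ?(meml exy) ?(memr exy) // y2 negbK => /andP[x2 xA] yA.
by rewrite e_sym in exy; have [] := A_cut exy yA xA x2.
Qed.

Lemma capped_outer_cut :
  capped (S :\: B) (remove_vertices e B) /\ capped (S :\: A) (remove_vertices e A).
Proof.
split.
  apply: (capped_remove_behind_edge zB (meml ez1) e12 v1B v2B) => x y xB yB /(B_nbrs xB yB)[|[]];
  by [right|left].
apply: (capped_remove_behind_edge v1A (memr ez1) ez2 zA v2A) => x y xA yA exy.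
have [->|y2] := eqVneq y v2; first by right.
by have [_ ->] := A_cut exy xA yA y2; left.
Qed.

Lemma edges_at_outer_cut : remove_vertices (remove_vertices e A) [set z] =2
  edges_at (remove_edge (remove_vertices e [set z]) v1 v2) B.
Proof.
have B_side x y : x != z -> e x y -> x \in B -> (x \notin A) && (y \notin A).
  move=> xz exy xB; move: (xB); rewrite memB ?(meml exy) // => /andP[x2 ->] /=.
  apply: contra xz => yA; have yB : y \notin B by rewrite memB ?(memr exy) // yA andbF.
  by case: (B_nbrs xB yB exy) => [y2|[-> _]//]; case/negP: v2A; rewrite -y2.
move=> x y; rewrite /edges_at /remove_edge {1 3}/remove_vertices !in_set1.
rewrite [in LHS]/remove_vertices.
have [exy|//] := boolP (e x y); have eyx : e y x by rewrite e_sym.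
have [|xz] := eqVneq x z; first by rewrite !andbF.
have [|yz] := eqVneq y z; first by rewrite !andbF.
rewrite /= !andbT; have [xyB|] := boolP ((x \in B) || (y \in B)).
  have /andP[xA yA] : (x \notin A) && (y \notin A).
    by case/orP: xyB => [xB|yB]; [|rewrite andbC]; apply: B_side.
  rewrite xA yA !andbT; apply/esym/negP => /orP[]/andP[/eqP xE /eqP yE];
    [by rewrite xE v1A in xA|by rewrite yE v1A in yA].
rewrite !memB ?(meml exy) ?(memr exy) // negb_or andbF => /andP[xB yB].
apply/negbTE/negP => /andP[xA yA]; rewrite xA yA !andbT !negbK in xB yB.
by have := e_neq exy; rewrite (eqP xB) (eqP yB) eqxx.
Qed.

Lemma outer_cut_glue : outer_edge_capped e z v1 v2.
Proof.
have [capB capA] := capped_outer_cut.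
apply: (bounded_monomial_glue (U := B) (b := cap [set v1; v2] set0)
  (b' := cap [set v2] (nbhd (remove_vertices e A) z))).
- apply: eq_bounded_monomial (capped_edge capB _); last by rewrite /remove_vertices e12 v1B.
  move=> x y; rewrite -remove_edge_vertices /remove_edge remove_verticesC; congr (_ && _).
  have notin_B u : u \notin B -> u \notin [set z] by rewrite inE; apply: contraNneq => ->.
  rewrite {2}/remove_vertices; case: (boolP (remove_vertices e B x y)) => //= /and3P[_ xB yB].
  by rewrite !notin_B.
- apply: eq_bounded_monomial edges_at_outer_cut (capped_outer_root capA _).
  by rewrite /remove_vertices ez2 zA.
- move=> x y /andP[/and3P[exy _ yz] _] xB yB; rewrite /cap.
  have [->|[yE _]] := B_nbrs yB xB (etrans (e_sym y x) exy); first by rewrite set11.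
  by rewrite yE set11 in yz.
- move=> x; case: ifPn => xB; apply: cap_le; rewrite !inE //.
  + by case/orP=> /eqP xE; rewrite xE ?(negPf v1B) ?(negPf v2B) in xB.
  + move=> ezx; rewrite /remove_vertices ezx zA.
    by move: xB; rewrite memB ?(memr ezx) // => /andP[_ ->].
  + by move=> ezx; case: (B_nbrs zB xB ezx) => [->|[_ ->]]; rewrite eqxx ?orbT.
Qed.

End OuterCut.

Lemma outer_edge_step_cut z v1 v2 : e z v1 -> e z v2 -> e v1 v2 ->
  (forall x, e z x -> e v1 x -> x = v2) -> outer_edge_capped e z v1 v2.
Proof.
move=> ez1 ez2 e12 common; have e1z : e v1 z by rewrite e_sym.
have commonE : common_nbrs e v1 z = [set v2].
  by apply/setP => x; rewrite !inE; apply/andP/eqP => [[e1x ezx]|->//]; apply: common.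
have [|A [v1A zA AS A_v2 A_cut]] := planar_edge_cut pl e1z; first by rewrite commonE cards1.
rewrite commonE in A_v2 A_cut; have v2A : v2 \notin A by rewrite (disjointFl A_v2 (set11 v2)).
apply: (outer_cut_glue ez1 ez2 e12 v1A v2A zA) => x y exy xA yA y2.
by apply: A_cut; rewrite // in_set1.
Qed.

Lemma outer_edge_step z v1 v2 : e z v1 -> e z v2 -> e v1 v2 ->
  outer_edge_capped e z v1 v2.
Proof.
move=> ez1 ez2 e12.
have [v /and3P[ezv e1v vv2]|none] := pickP (fun x => [&& e z x, e v1 x & x != v2]); last first.
  by apply: outer_edge_step_cut => // x ezx e1x; have := none x; rewrite ezx e1x => /negbFE/eqP.
have v1_common : v1 \in common_nbrs e z v by rewrite inE ez1 e_sym.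
have [p [q [p_common q_common chord]]] := planar_chord pl ezv v1_common.
have [b /and4P[ezb evb bp bq]|none] := pickP (fun b => [&& e z b, e v b, b != p & b != q]).
  have common_out x : x \in common_nbrs e z v -> b != x -> x \in S /\ x \notin [set z; v; b].
    rewrite !inE ![x == _]eq_sym => /andP[ezx evx] bx; rewrite (memr ezx).
    by rewrite (negPf (e_neq ezx)) (negPf (e_neq evx)) (negPf bx).
  have [pS pK] := common_out p p_common bp; have [qS qK] := common_out q q_common bq.
  apply: (outer_edge_step_chord ez1 ez2 e12 ezv ezb evb pS qS pK qK).
  by apply: chord; rewrite ?inE ?ezb.
have common_pq x : e z x -> e v x -> x = p \/ x = q.
  move=> ezx evx; have := none x; rewrite ezx evx /= => /negbT.
  by rewrite negb_and !negbK => /orP[]/eqP; [left|right].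
have [w common_w] : exists w, forall x, e z x -> e v x -> x = v1 \/ x = w.
  have ev1 : e v v1 by rewrite e_sym.
  have [->|->] := common_pq v1 ez1 ev1; first by exists q => x; apply: common_pq.
  by exists p => x ezx evx; apply/or_comm/common_pq.
exact: outer_edge_step_contract common_w.
Qed.

Lemma capped_step : capped S e.
Proof.
have edge_cap u v : e u v -> edge_capped e u v set0.
  move=> euv; have [w /andP[euw evw]|none] := pickP (fun w => e u w && e v w).
    have [ewu ewv] : e w u /\ e w v by rewrite !(e_sym w).
    exact: edge_step_common ewu ewv euv (outer_edge_step ewu ewv euv).
  by apply: edge_step_bridge => //; apply/setP => x; rewrite !inE none.
split=> // [v|z v ezv|z u v]; [exact: root_step| |exact: outer_edge_step].
have [v' /andP[ezv' v'v]|none] := pickP (fun x => e z x && (x != v)); last first.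
  by apply: outer_root_step_pendant => // x ezx; have := none x; rewrite ezx => /negbFE/eqP.
have [b /andP[ezb evb]|none_common] := pickP (fun b => e z b && e v b); last first.
  by apply: (outer_root_step_bridge ezv ezv' v'v); apply/setP => x; rewrite !inE none_common.
have ebv : e b v by rewrite e_sym.
exact: outer_root_step_common ezv ezb ebv (outer_edge_step ezb ezv ebv).
Qed.

End Step.

Lemma planar_capped S e : planar S e -> capped S e.
Proof.
have [n] := ubnP #|S|; elim: n S e => // n IH S e S_lt pl.
by apply: (capped_step pl) => S' e' pl' S'_lt; apply: IH pl'; apply: leq_trans S'_lt S_lt.
Qed.

End CappedMonomials.

(** * Lattice maps with prescribed regions *)

Definition box (n : nat) : seq cell :=
  [seq (i%:Z - n%:Z, j%:Z - n%:Z) | i <- iota 0 (n + n).+1, j <- iota 0 (n + n).+1].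

Lemma mem_box n (c : cell) :
  (c \in box n) = [&& - n%:Z <= c.1, c.1 <= n%:Z, - n%:Z <= c.2 & c.2 <= n%:Z].
Proof.
apply/allpairsP/idP => [[[i j] [ij ij' ->]]|c_le].
  by move: ij ij'; rewrite !mem_iota /=; lia.
exists (`|(c.1 + n%:Z)%R|%N, `|(c.2 + n%:Z)%R|%N); rewrite !mem_iota /=.
by split; [lia|lia|apply: cellP => /=; lia].
Qed.

Lemma cell_connected_outside_box n : cell_connected (fun c => c \notin box n).
Proof.
move=> P P_closed.
have row j i i' : (n%:Z < j) || (j < - n%:Z) -> P (i, j) -> P (i', j).
  move=> j_out; apply: (cell_connected_line (f := pair^~ j) P_closed) => k; last exact: adjc_row.
  by rewrite mem_box /=; lia.
have column i j j' : (n%:Z < i) || (i < - n%:Z) -> P (i, j) -> P (i, j').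
  move=> i_out; apply: (cell_connected_line (f := pair i) P_closed) => k; last exact: adjc_column.
  by rewrite mem_box /=; lia.
have corner_out : (n%:Z < n.+1%:Z) || (n.+1%:Z < - n%:Z) by lia.
have outP (c : cell) : c \notin box n ->
    (n%:Z < c.1) || (c.1 < - n%:Z) \/ (n%:Z < c.2) || (c.2 < - n%:Z).
  by rewrite mem_box; lia.
move=> [i j] [i' j'] /outP /= ij_out /outP /= ij'_out Pij.
have Pcorner : P (n.+1%:Z, n.+1%:Z).
  case: ij_out => out; first exact: (row _ i _ corner_out) (column _ j _ out Pij).
  exact: (column _ j _ corner_out) (row _ i _ out Pij).
case: ij'_out => out; first exact: (column _ n.+1%:Z _ out) (row _ n.+1%:Z _ corner_out Pcorner).
exact: (row _ n.+1%:Z _ out) (column _ n.+1%:Z _ corner_out Pcorner).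
Qed.

Lemma cell_connected_hub (J : Type) (H : cell -> Prop) (B : J -> cell -> Prop) :
  cell_connected H -> (forall j, cell_connected (B j)) -> (forall j, exists2 c, H c & B j c) ->
  (exists c, H c) -> cell_connected (fun c => H c \/ exists j, B j c).
Proof.
move=> cH cB meet [h Hh] P P_closed; pose A c := H c \/ exists j, B j c.
have P_iff a b : A a -> A b -> adjc a b -> (P a <-> P b).
  by move=> Aa Ab ab; split; apply: P_closed => //; rewrite adjc_sym.
have P_hub c : H c -> (P c <-> P h).
  move=> Hc; apply: (cH (fun c => P c <-> P h) _ h) => // a b Ha Hb ab <-.
  by apply: iff_sym; apply: P_iff => //; left.
suff P_all c : A c -> (P c <-> P h) by move=> a b /P_all Pa /P_all Pb /Pa /Pb.
case=> [/P_hub //|[j Bc]]; have [d Hd Bd] := meet j.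
apply: (cB j (fun c => P c <-> P h) _ d) => //; last exact: P_hub.
by move=> a b Ba Bb ab <-; apply: iff_sym; apply: P_iff => //; right; exists j.
Qed.

Definition cell_component (A : cell -> Prop) (a c : cell) : Prop :=
  forall P : cell -> Prop, (forall x y, A x -> A y -> adjc x y -> P x -> P y) -> P a -> P c.

Section CellComponent.
Variables (A : cell -> Prop) (a : cell).
Hypothesis Aa : A a.

Lemma cell_component_sub c : cell_component A a c -> A c.
Proof. by move=> /(_ A); apply. Qed.

Lemma cell_component_adjc c d :
  cell_component A a c -> A d -> adjc c d -> cell_component A a d.
Proof.
move=> comp_c Ad cd P P_closed Pa; apply: (P_closed c) => //; last exact: comp_c.
exact: cell_component_sub.
Qed.

Lemma cell_component_max (B : cell -> Prop) c : cell_connected B -> (forall x, B x -> A x) ->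
  B a -> B c -> cell_component A a c.
Proof. by move=> cB BA Ba Bc P P_closed; apply: cB => // x y /BA Ax /BA Ay; apply: P_closed. Qed.

Lemma cell_component_connected : cell_connected (cell_component A a).
Proof.
move=> P P_closed.
suff Pa c : cell_component A a c -> (P c <-> P a) by move=> x y /Pa Px /Pa Py /Px /Py.
move=> /(_ (fun c => cell_component A a c /\ (P c <-> P a))) [||//]; last by split.
move=> x y Ax Ay xy [comp_x <-]; have comp_y := cell_component_adjc comp_x Ay xy.
by split=> //; split; apply: P_closed => //; rewrite adjc_sym.
Qed.

End CellComponent.

Definition planar_subgraph (I E : Type) (s t : E -> I) : Prop :=
  exists (W : finType) (S : {set W}) (e : rel W) (i : I -> W),
    [/\ injective i, planar S e & forall k, e (i (s k)) (i (t k))].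

Section Assembly.
Variables (I E : finType) (A : I -> cell -> Prop) (C : E -> cell -> Prop) (s t : E -> I).
Variables (base : I -> cell) (outer : I) (b : seq cell).
Hypothesis A_base : forall i, A i (base i).
Hypothesis A_connected : forall i, cell_connected (A i).
Hypothesis A_disjoint : forall i j c, A i c -> A j c -> i = j.
Hypothesis A_cofinite : forall c, c \notin b -> A outer c.
Hypothesis C_connected : forall k, cell_connected (C k).
Hypothesis C_disjoint : forall k k' c, C k c -> C k' c -> k = k'.
Hypothesis C_meets_s : forall k, exists2 c, C k c & A (s k) c.
Hypothesis C_meets_t : forall k, exists2 c, C k c & A (t k) c.
Hypothesis C_meets_only : forall k i c, C k c -> A i c -> i = s k \/ i = t k.
Hypothesis st_neq : forall k, s k <> t k.

Let corridor k c := A (s k) c \/ C k c /\ ~ A (t k) c.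
Let reach k := cell_component (corridor k) (base (s k)).

(* The region of [s k] is extended along [C k] until it touches the region of [t k]. *)
Let extended i c := A i c \/ exists j : {k | s k = i}, reach (sval j) c.

Let corridor_base k : corridor k (base (s k)). Proof. by left. Qed.

Let reach_s k c : A (s k) c -> reach k c.
Proof. by move=> Ac; apply: (@cell_component_max _ _ (A (s k))) => // x; left. Qed.

Lemma extended_connected i : cell_connected (extended i).
Proof.
apply: cell_connected_hub => // [j|[k ski] /=|]; last by exists (base i).
  exact: cell_component_connected.
by exists (base i); rewrite // -ski; apply: reach_s.
Qed.

Lemma extended_disjoint i j c : extended i c -> extended j c -> i = j.
Proof.
have reach_A k i' : reach k c -> A i' c -> s k = i'.
  move=> /(cell_component_sub (corridor_base k))[Ac|[Cc nAc]] Ai'; first exact: A_disjoint Ac Ai'.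
  by case: (C_meets_only Cc Ai') => // i't; rewrite i't in Ai'.
case=> [Ai|[[k ski] /= rk]] [Aj|[[k' sk'j] /= rk']].
- exact: A_disjoint Ai Aj.
- by rewrite -sk'j (reach_A k' i).
- by rewrite -ski (reach_A k j).
rewrite -ski -sk'j.
have [Ak|[Ck _]] := cell_component_sub (corridor_base k) rk; first by rewrite (reach_A k' (s k)).
have [Ak'|[Ck' _]] := cell_component_sub (corridor_base k') rk'; first exact: reach_A rk Ak'.
by rewrite (C_disjoint Ck Ck').
Qed.

Lemma extended_touch k : exists c d, [/\ adjc c d, extended (s k) c & extended (t k) d].
Proof.
apply: contrapT => no_touch.
have [c Cc Ac] := C_meets_s k; have [d Cd Ad] := C_meets_t k.
have : reach k d.
  apply: (C_connected (k := k) (P := reach k) _ Cc Cd); last exact: reach_s.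
  move=> x y Cx Cy xy reach_x; apply: cell_component_adjc (xy) => //; right; split=> // Ay.
  apply: no_touch; exists x, y; split=> //; last by left.
  by right; exists (exist (fun k' => s k' = s k) k erefl).
move=> /(cell_component_sub (corridor_base k))[As|[_]//].
by apply: (st_neq (k := k)); apply: A_disjoint As Ad.
Qed.

Lemma planar_assembly : planar_subgraph s t.
Proof.
pose W := (I + seq_sub b)%type.
pose label_spec c (w : W) := match w with
  | inl i => extended i c | inr x => ssval x = c /\ ~ exists i, extended i c end.
have label_exists c : exists w, label_spec c w.
  have [[i Ai]|none] := pselect (exists i, extended i c); first by exists (inl i).
  have cb : c \in b by apply/negPn/negP => /A_cofinite Ac; apply: none; exists outer; left.
  by exists (inr (SeqSub cb)).
have [l l_spec] := choice label_exists.
have l_inl c i : l c = inl i <-> extended i c.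
  split=> [lc|Ai]; have := l_spec c; first by rewrite lc.
  case: (l c) => [j Aj|x [_ none]]; first by rewrite (extended_disjoint Ai Aj).
  by case: none; exists i.
have l_inr c x : l c = inr x -> ssval x = c by move=> lc; have := l_spec c; rewrite lc => -[].
pose e : rel W := fun x y =>
  `[< x != y /\ exists c d, [/\ adjc c d, l c = x & l d = y] >].
pose S := [set x : W | `[< exists c, l c = x >]].
exists W, S, e, inl; split=> [i j []//||k]; last first.
  apply/asboolP; split; first by apply/eqP => -[]; apply: st_neq.
  have [c [d [cd Ac Ad]]] := extended_touch k.
  by exists c, d; split=> //; apply/l_inl.
exists l; split.
- case=> [i|x]; last by move=> P _ c d /l_inr <- /l_inr <-.
  rewrite (_ : (fun c => l c = inl i) = extended i); first exact: extended_connected.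
  by apply/funext => c; apply/propext.
- by move=> x; rewrite inE; split => /asboolP.
- by move=> x y; split => /asboolP.
- by exists (inl outer), b => c /A_cofinite Ac; apply/l_inl; left.
Qed.

End Assembly.

From mathcomp Require Import all_classical all_reals all_analysis lra.
Import numFieldNormedType.Exports.
Local Open Scope classical_set_scope.
Local Open Scope ring_scope.

(** * Grids in the plane *)

Lemma connected_locally_constant (T : topologicalType) (K : set T) (Q : T -> Prop) :
  connected K -> (forall x, K x -> \forall y \near x, K y -> (Q x <-> Q y)) ->
  forall x y, K x -> K y -> Q x -> Q y.
Proof.
move=> cK Q_locally x y Kx Ky Qx.
suff KQ : K `&` Q = K by have : (K `&` Q) y by [rewrite KQ]; case.
apply: cK; first by exists x.
- exists (interior [set z | K z -> Q z]); first exact: open_interior.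
  apply/seteqP; split => z [Kz Qz]; split => //; last exact: (interior_subset Qz).
  by apply: filterS (Q_locally z Kz) => w QzQw Kw; apply/(QzQw Kw).
- exists (~` interior [set z | K z -> ~ Q z]); first by apply: open_closedC; exact: open_interior.
  apply/seteqP; split => z [Kz Qz]; split => //; first by move=> /interior_subset /(_ Kz).
  apply: contrapT => nQz; apply: Qz.
  by apply: filterS (Q_locally z Kz) => w QzQw Kw /(QzQw Kw).
Qed.

Section NormedSpace.
Variables (R : realType) (V : normedModType R).
Implicit Types (x y a b : V) (K L U : set V).

Lemma disjoint_compact_gap K L : compact K -> compact L -> K `&` L = set0 ->
  \forall e \near (0 : R)^'+, forall x y, K x -> L y -> e <= `|x - y|.
Proof.
move=> cK cL KL; have [[[a b] [/= Ka Lb]]|empty] := pselect (K `*` L !=set0); last first.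
  by apply: nearW => e x y Kx Ly; case: empty; exists (x, y).
pose dist (p : V * V) : R := `|p.1 - p.2|.
have dist_cts : continuous dist.
  by move=> p; apply: cvg_norm; apply: cvgB; [exact: cvg_fst|exact: cvg_snd].
have [||c KLc dist_min] := @compact_EVT_min _ _ dist (K `*` L) _ (compact_setX cK cL).
- by exists (a, b).
- exact: continuous_subspaceT.
have dist_gt0 : 0 < dist c.
  rewrite normr_gt0 subr_eq0; apply/eqP => c12.
  have : (K `&` L) c.1 by have [? ?] := set_mem KLc; split; rewrite // c12.
  by rewrite KL.
apply: filterS (nbhs_right_le dist_gt0) => e e_le x y Kx Ly.
by apply: le_trans e_le (dist_min (x, y) _); apply: mem_set.
Qed.

Lemma compact_point_gap K a : compact K -> ~ K a ->
  \forall e \near (0 : R)^'+, forall x, K x -> e <= `|x - a|.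
Proof.
move=> K_compact Ka; have disjoint : K `&` [set a] = set0.
  by rewrite -subset0 => x [Kx xa]; apply: Ka; rewrite -xa.
apply: filterS (disjoint_compact_gap K_compact (@compact_set1 _ a) disjoint) => e e_gap x Kx.
exact: e_gap.
Qed.

Definition line_segment a b : set V := (fun t : R => a + t *: (b - a)) @` `[0, 1].

Let line_continuous a b : continuous (fun t : R => a + t *: (b - a)).
Proof. by move=> t; apply: cvgD; [exact: cvg_cst|apply: cvgZr_tmp; exact: cvg_id]. Qed.

Lemma line_segment_compact a b : compact (line_segment a b).
Proof.
by apply: continuous_compact; [exact/continuous_subspaceT/line_continuous|exact: segment_compact].
Qed.

Lemma line_segment_connected a b : connected (line_segment a b).
Proof.
apply: connected_continuous_connected; first exact: segment_connected.
exact/continuous_subspaceT/line_continuous.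
Qed.

Lemma line_segment_left a b : line_segment a b a.
Proof. by exists 0; rewrite ?scale0r ?addr0 //= in_itv /= lexx ler01. Qed.

Lemma line_segment_right a b : line_segment a b b.
Proof. by exists 1; rewrite ?scale1r /= ?in_itv /= ?lexx ?ler01 // addrC subrK. Qed.

Lemma line_segment_norm a b x : line_segment a b x -> `|x - a| <= `|b - a|.
Proof.
move=> [t /=]; rewrite in_itv /= => /andP[t_ge0 t_le1] <-.
by rewrite addrC addKr normrZ (ger0_norm t_ge0) ler_piMl.
Qed.

Lemma open_component_continuum U x y : open U -> connected_component U x y ->
  exists K, [/\ compact K, connected K, K `<=` U, K x & K y].
Proof.
move=> oU [C [Cx CU cC] Cy].
pose joined y := exists K, [/\ compact K, connected K, K `<=` U, K x & K y].
apply: (connected_locally_constant (Q := joined) cC _ Cx Cy) => [z Cz|]; last first.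
  exists [set x]; split=> //; [exact: compact_set1|exact: connected1|].
  by move=> _ ->; apply: CU.
have /nbhs_ballP[e /= e_gt0 ball_U] : nbhs z U.
  by apply: open_nbhs_nbhs; split=> //; apply: CU.
apply/nbhs_ballP; exists e => //= w zw Cw.
have segment_U : line_segment z w `<=` U.
  move=> p /line_segment_norm pz_le; apply: ball_U; rewrite -ball_normE /= distrC.
  by apply: le_lt_trans pz_le _; move: zw; rewrite -ball_normE /= distrC.
have extend a b : line_segment z w a -> line_segment z w b -> joined a -> joined b.
  move=> za zb [K [cK connK KU Kx Ka]]; exists (K `|` line_segment z w); split.
  - by apply: compactU => //; exact: line_segment_compact.
  - by apply: connectedU => //; [exists a|exact: line_segment_connected].
  - by move=> p [/KU|/segment_U].
  - by left.
  - by right.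
by split; apply: extend; [exact: line_segment_left|exact: line_segment_right
                         |exact: line_segment_right|exact: line_segment_left].
Qed.

Lemma unbounded_exceeds (C : set V) (M : R) : ~ bounded_set C -> exists2 y, C y & M < `|y|.
Proof.
move=> unbounded; apply: contrapT => none; apply: unbounded; exists M; split; first exact: num_real.
move=> N MN y Cy; apply: le_trans (ltW MN); rewrite leNgt; apply/negP => My; apply: none.
by exists y.
Qed.

Lemma compact_family_bounded (I : finType) (F : I -> set V) : (forall i, compact (F i)) ->
  \forall M \near +oo, forall i x, F i x -> `|x| <= M.
Proof.
move=> F_compact; apply: filter_forall => i.
by have [M [M_real FM]] := compact_bounded (F_compact i); exists M; split=> // N MN x; apply: FM.
Qed.

End NormedSpace.

Lemma compact_bigcup_fin (T : topologicalType) (I : finType) (F : I -> set T) :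
  (forall i, compact (F i)) -> compact (\bigcup_i F i).
Proof.
move=> F_compact; have -> : \bigcup_i F i = \big[setU/set0]_(i <- enum I) F i.
  by rewrite -bigcup_seq; apply: eq_bigcupl; split=> i //= _; exact: mem_enum.
exact: bigsetU_compact.
Qed.

Section Grid.
Variable R : realType.
Local Notation plane := (R * R)%type.
Implicit Types (h M t : R) (x y : plane) (K L : set plane).

Definition grid_cell h x : cell := (Num.floor (x.1 / h), Num.floor (x.2 / h)).

Lemma grid_cell_dist h x y : 0 < h -> grid_cell h x = grid_cell h y -> `|x - y| < h.
Proof.
move=> h_gt0 [floor1 floor2]; rewrite prod_normE gt_max /=.
have floor_dist (s t : R) : Num.floor (s / h) = Num.floor (t / h) -> `|s - t| < h.
  move=> st; have /andP[s_ge s_lt] := floor_itv (s / h); have /andP[t_ge t_lt] := floor_itv (t / h).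
  rewrite st in s_ge s_lt; rewrite intrD in s_lt t_lt.
  have : `|s / h - t / h| < 1 by rewrite ltr_norml; apply/andP; split; lra.
  by rewrite -mulrBl normrM normfV (gtr0_norm h_gt0) ltr_pdivrMr // mul1r.
by rewrite !floor_dist.
Qed.

Lemma floor_near (t : R) :
  \forall s \near t, Num.floor s = Num.floor t \/ Num.floor s = Num.floor t - 1.
Proof.
have /andP[t_ge t_lt] := floor_itv t; rewrite intrD in t_lt.
apply/nbhs_ballP; exists (Num.min 1 ((Num.floor t)%:~R + 1 - t)) => /=.
  by rewrite lt_min ltr01 /=; lra.
move=> s; rewrite /ball /= lt_min !ltr_norml => /andP[/andP[ts_gt ts_lt] /andP[st_gt st_lt]].
have floor_lt : Num.floor s < Num.floor t + 1 by rewrite floor_lt_int intrD; lra.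
have floor_ge : Num.floor t - 1 <= Num.floor s by rewrite floor_ge_int intrB; lra.
by have [->|->] : Num.floor s = Num.floor t \/ Num.floor s = Num.floor t - 1 by [lia]; [left|right].
Qed.

(* Since squares are half-open, the squares of points close to [x] only differ from that
   of [x] by [(0,0)], [(1,0)], [(0,1)] or [(1,1)]: this is adjacency in the lattice. *)
Lemma grid_cell_near h x :
  \forall y \near x, grid_cell h y = grid_cell h x \/ adjc (grid_cell h y) (grid_cell h x).
Proof.
have near1 : \forall y \near x, Num.floor (y.1 / h) = Num.floor (x.1 / h) \/
    Num.floor (y.1 / h) = Num.floor (x.1 / h) - 1.
  by apply: (cvgM cvg_fst (cvg_cst _)) (floor_near _).
have near2 : \forall y \near x, Num.floor (y.2 / h) = Num.floor (x.2 / h) \/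
    Num.floor (y.2 / h) = Num.floor (x.2 / h) - 1.
  by apply: (cvgM cvg_snd (cvg_cst _)) (floor_near _).
apply: filterS2 near1 near2 => y floor1 floor2; rewrite /grid_cell /adjc /forward.
by case: floor1 floor2 => [->|->] [->|->]; [left|right|right|right];
  rewrite // !inE !xpair_eqE /=; lia.
Qed.

Definition grid_cells h K (c : cell) : Prop := exists2 x, K x & grid_cell h x = c.

Lemma grid_cells_connected h K : connected K -> cell_connected (grid_cells h K).
Proof.
move=> cK P P_closed _ _ [x Kx <-] [y Ky <-].
apply: (connected_locally_constant (Q := fun x => P (grid_cell h x)) cK _ Kx Ky) => z Kz.
apply: filterS (grid_cell_near h z) => w near_zw Kw.
case: near_zw => [->//|wz]; have zw := wz; rewrite adjc_sym in zw.
by split; apply: P_closed => //; [exists z|exists w|exists w|exists z].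
Qed.

Definition grid_resolves h K L : Prop :=
  forall c, grid_cells h K c -> grid_cells h L c -> K `&` L !=set0.

Lemma fine_grid (I : finType) (F : I -> set plane) : (forall i, compact (F i)) ->
  \forall h \near (0 : R)^'+, forall i j, grid_resolves h (F i) (F j).
Proof.
move=> F_compact; apply: filter_forall => i; apply: filter_forall => j.
have [[x FFx]|/nonemptyPn disjoint] := pselect (F i `&` F j !=set0).
  by apply: nearW => h c _ _; exists x.
have gap := disjoint_compact_gap (F_compact i) (F_compact j) disjoint.
apply: filterS2 gap (nbhs_right_gt 0) => h h_gap h_gt0 c [x Fx xc] [y Fy yc].
by have := h_gap x y Fx Fy; rewrite leNgt (grid_cell_dist h_gt0) // xc.
Qed.

Lemma floor_div_bounded h M t : 0 < h -> `|t| <= M ->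
  - (Num.floor (M / h) + 2) <= Num.floor (t / h) <= Num.floor (M / h) + 2.
Proof.
move=> h_gt0; rewrite ler_norml => /andP[t_ge t_le].
have /andP[floor_le floor_gt] := floor_itv (M / h); rewrite intrD in floor_gt.
have th_le : t / h <= M / h by rewrite ler_pM2r // invr_gt0.
have th_ge : - (M / h) <= t / h by rewrite -mulNr ler_pM2r // invr_gt0.
apply/andP; split; first by rewrite floor_ge_int intrN intrD; lra.
by apply/ltW; rewrite floor_lt_int intrD; lra.
Qed.

Lemma floor_div_far h M t : 0 < h <= 1 -> M + 4 < `|t| ->
  (Num.floor (M / h) + 2 < Num.floor (t / h)) || (Num.floor (t / h) < - (Num.floor (M / h) + 2)).
Proof.
move=> /andP[h_gt0 h_le1]; have h_inv : 0 < h^-1 by rewrite invr_gt0.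
have h_inv1 : 1 <= h^-1 by rewrite invf_ge1.
have /andP[floor_le floor_gt] := floor_itv (M / h); rewrite intrD in floor_gt.
have Mh_le : M / h + 4 <= (M + 4) / h by rewrite mulrDl; nra.
rewrite ltr_normr => /orP[t_gt|t_gt]; apply/orP; [left|right].
  have th_gt : (M + 4) / h < t / h by rewrite ltr_pM2r.
  suff : Num.floor (M / h) + 3 <= Num.floor (t / h) by lia.
  by rewrite floor_ge_int intrD; lra.
have th_gt : (M + 4) / h < - t / h by rewrite ltr_pM2r.
by rewrite floor_lt_int intrN intrD; rewrite mulNr in th_gt; lra.
Qed.

Lemma grid_box h M : 0 < h <= 1 -> 0 <= M -> exists n : nat,
  (forall x, `|x| <= M -> grid_cell h x \in box n) /\
  (forall x, M + 4 < `|x| -> grid_cell h x \notin box n).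
Proof.
move=> h_bounds M_ge0; have /andP[h_gt0 _] := h_bounds.
have N_ge0 : 0 <= Num.floor (M / h) by rewrite floor_ge_int divr_ge0 // ltW.
exists (`|Num.floor (M / h)|%N + 2)%N.
have nE : (`|Num.floor (M / h)|%N + 2)%N%:Z = Num.floor (M / h) + 2 by lia.
split=> x; rewrite mem_box nE prod_normE /grid_cell /=.
  rewrite ge_max => /andP[x1_le x2_le].
  by have := floor_div_bounded h_gt0 x1_le; have := floor_div_bounded h_gt0 x2_le; lia.
by rewrite lt_max => /orP[] /(floor_div_far h_bounds); lia.
Qed.

End Grid.

Section Discretization.
Variables (R : realType) (V E : finType).
Local Notation plane := (R * R)%type.
Variables (X : V -> set plane) (C : E -> set plane) (s : E -> V) (t : E -> option V).
Hypothesis X_compact : forall v, compact (X v).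
Hypothesis X_connected : forall v, connected (X v).
Hypothesis X_nonempty : forall v, X v !=set0.
Hypothesis X_disjoint : forall u v, X u `&` X v !=set0 -> u = v.
Hypothesis C_compact : forall k, compact (C k).
Hypothesis C_connected : forall k, connected (C k).
Hypothesis C_disjoint : forall k k', C k `&` C k' !=set0 -> k = k'.
Hypothesis C_meets_s : forall k, C k `&` X (s k) !=set0.
Hypothesis C_meets_t : forall k v, t k = Some v -> C k `&` X v !=set0.
Hypothesis C_meets_only : forall k v, C k `&` X v !=set0 -> v = s k \/ Some v = t k.
Hypothesis st_neq : forall k, Some (s k) <> t k.

Section OnGrid.
Variables (h : R) (n : nat) (Q : E -> set plane).
Hypothesis box_X : forall v x, X v x -> grid_cell h x \in box n.
Hypothesis box_C : forall k x, C k x -> grid_cell h x \in box n.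
Hypothesis Q_connected : forall k, connected (Q k).
Hypothesis Q_meets_C : forall k, t k = None -> C k `&` Q k !=set0.
Hypothesis Q_exits : forall k, t k = None -> exists2 y, Q k y & grid_cell h y \notin box n.
Hypothesis Q_X : forall k v, Q k `&` X v = set0.
Hypothesis Q_C : forall k k', t k <> None -> C k `&` Q k' = set0.
Hypothesis resolves_XX : forall u v, grid_resolves h (X u) (X v).
Hypothesis resolves_CX : forall k v, grid_resolves h (C k) (X v).
Hypothesis resolves_CC : forall k k', grid_resolves h (C k) (C k').
Hypothesis resolves_QX : forall k v, grid_resolves h (Q k) (X v).
Hypothesis resolves_CQ : forall k k', grid_resolves h (C k) (Q k').

(* The outer region joins the cells outside the box to the ends of the open connectors. *)
Let region (i : option V) (c : cell) : Prop := match i with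
  | Some v => grid_cells h (X v) c
  | None => c \notin box n \/ exists k : {k | t k = None}, grid_cells h (Q (sval k)) c end.

Let region_connected i : cell_connected (region i).
Proof.
case: i => [v|]; first exact: grid_cells_connected.
apply: cell_connected_hub.
- exact: cell_connected_outside_box.
- by move=> k; apply: grid_cells_connected.
- by move=> [k /= tk]; have [y Qy y_out] := Q_exits tk; exists (grid_cell h y) => //; exists y.
- by exists (n.+1%:Z, n.+1%:Z); rewrite mem_box /=; lia.
Qed.

Let outer_inner v c : region (Some v) c -> ~ region None c.
Proof.
move=> Xc; case: (Xc) => x Xx xc [|[k Qc]]; first by rewrite -xc (box_X Xx).
by have := resolves_QX Qc Xc; rewrite Q_X => -[].
Qed.

Let region_disjoint i j c : region i c -> region j c -> i = j.
Proof.
case: i => [u|]; case: j => [v|] // ic jc.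
- by congr Some; apply/X_disjoint/(resolves_XX ic jc).
- by case: (outer_inner ic).
- by case: (outer_inner jc).
Qed.

Let connector_meets_only k i c : grid_cells h (C k) c -> region i c -> i = Some (s k) \/ i = t k.
Proof.
case: i => [v|] Cc ic.
  by case: (C_meets_only (resolves_CX Cc ic)) => [->|]; [left|right].
right; case tk: (t k) => [v|//]; case: ic => [|[k' Qc]].
  by case: Cc => x Cx <-; rewrite (box_C Cx).
have := resolves_CQ Cc Qc; rewrite Q_C; first by case.
by rewrite tk.
Qed.

Lemma planar_discretization_on_grid : planar_subgraph (Some \o s) t.
Proof.
have region_nonempty i : exists c, region i c.
  case: i => [v|]; first by have [x Xx] := X_nonempty v; exists (grid_cell h x); exists x.
  by exists (n.+1%:Z, n.+1%:Z); left; rewrite mem_box /=; lia.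
have [base base_region] := choice region_nonempty.
apply: (@planar_assembly _ E region (fun k => grid_cells h (C k)) (Some \o s) t base None (box n)).
- exact: base_region.
- exact: region_connected.
- exact: region_disjoint.
- by left.
- by move=> k; apply: grid_cells_connected.
- by move=> k k' c Ck Ck'; apply/C_disjoint/(resolves_CC Ck Ck').
- by move=> k; have [x [Cx Xx]] := C_meets_s k; exists (grid_cell h x); exists x.
- move=> k; case tk: (t k) => [v|] /=.
    by have [x [Cx Xx]] := C_meets_t tk; exists (grid_cell h x); exists x.
  have [x [Cx Qx]] := Q_meets_C tk; exists (grid_cell h x); first by exists x.
  by right; exists (exist _ k tk); exists x.
- exact: connector_meets_only.
- exact: st_neq.
Qed.

End OnGrid.

Variable D : set plane.
Hypothesis D_closed : closed D.
Hypothesis X_D : forall v, X v `<=` D.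
Hypothesis C_D : forall k, t k <> None -> C k `<=` D.
Hypothesis C_escapes : forall k, t k = None ->
  exists2 q, C k q & ~ bounded_set (connected_component (~` D) q).

Let escape_route (M : R) k : exists Q, [/\ compact Q, connected Q, Q `<=` ~` D &
  t k = None -> C k `&` Q !=set0 /\ exists2 y, Q y & M < `|y|].
Proof.
have [tk|tk] := pselect (t k = None); last first.
  by exists set0; split=> //; [exact: compact0|exact: connected0].
have [q Cq /(unbounded_exceeds M)[y qy My]] := C_escapes tk.
have [Q [Q_compact Q_conn QD Qq Qy]] := open_component_continuum (closed_openC D_closed) qy.
by exists Q; split=> // _; split; [exists q|exists y].
Qed.

Lemma planar_discretization : planar_subgraph (Some \o s) t.
Proof.
have [M [M_ge0 [XM CM]]] : exists M, 0 <= M /\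
    (forall v x, X v x -> `|x| <= M) /\ (forall k x, C k x -> `|x| <= M).
  have M_ge0 : \forall M \near +oo, 0 <= M :> R by apply: nbhs_pinfty_ge.
  exact: filter_ex (filterI M_ge0
    (filterI (compact_family_bounded X_compact) (compact_family_bounded C_compact))).
have [Q Q_spec] := choice (escape_route (M + 4)).
pose F (j : V + E + E) := match j with inl (inl v) => X v | inl (inr k) => C k | inr k => Q k end.
have F_compact j : compact (F j) by case: j => [[v|k]|k] //=; have [] := Q_spec k.
have [h [resolves h_bounds]] :
    exists h, (forall i j, grid_resolves h (F i) (F j)) /\ 0 < h <= 1.
  have h_bounds : \forall h \near (0 : R)^'+, 0 < h <= 1.
    by apply: filterS2 (nbhs_right_gt 0) (nbhs_right_le ltr01) => h -> ->.
  apply: (@filter_ex _ (0 : R)^'+); apply: filterS2 (fine_grid F_compact) h_bounds => h.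
  by split.
have [n [box_in box_out]] := grid_box h_bounds M_ge0.
apply: (@planar_discretization_on_grid h n Q).
- by move=> v x /XM; apply: box_in.
- by move=> k x /CM; apply: box_in.
- by move=> k; have [] := Q_spec k.
- by move=> k tk; have [_ _ _ /(_ tk)[]] := Q_spec k.
- by move=> k tk; have [_ _ _ /(_ tk)[_ [y Qy My]]] := Q_spec k; exists y; rewrite ?box_out.
- move=> k v; rewrite -subset0 => x [Qx Xx]; have [_ _ QD _] := Q_spec k.
  exact: QD Qx (X_D Xx).
- move=> k k' tk; rewrite -subset0 => x [Cx Qx]; have [_ _ QD _] := Q_spec k'.
  exact: QD Qx (C_D tk Cx).
- by move=> u v; apply: (resolves (inl (inl u)) (inl (inl v))).
- by move=> k v; apply: (resolves (inl (inr k)) (inl (inl v))).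
- by move=> k k'; apply: (resolves (inl (inr k)) (inl (inr k'))).
- by move=> k v; apply: (resolves (inr k) (inl (inl v))).
- by move=> k k'; apply: (resolves (inl (inr k)) (inr k')).
Qed.

End Discretization.

(** * Plane graphs *)

Lemma is_arc_ends (R : realType) (p q : R * R) (A : set (R * R)) : is_arc p q A -> A p /\ A q.
Proof.
case=> f [_ _ <- <- ->].
by split; [exists 0|exists 1]; rewrite //= in_itv /= ?lexx ?ler01.
Qed.

Lemma boundary_edge_vertices (R : realType) (G : plane_graph R) (u v : G) :
  boundary_edge u v -> boundary_vertex u /\ boundary_vertex v.
Proof.
case=> uv uv_frontier; have [arc_u arc_v] := is_arc_ends (edge_arcP uv).
by split; apply: uv_frontier.
Qed.

Lemma image_itv_flip (R : realType) (T : Type) (f : R -> T) (a b : R) :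
  (fun t => f (1 - t)) @` `[a, b] = f @` `[1 - b, 1 - a].
Proof.
apply/seteqP; split=> _ [t /= t_ab <-]; exists (1 - t); rewrite ?subKr //;
  move: t_ab; rewrite /= !in_itv /=; lra.
Qed.

Section PlaneGraph.
Variables (R : realType) (G : plane_graph R).
Local Notation plane := (R * R)%type.
Implicit Types (u v w a b c d : G) (x y : plane) (r s t : R).

Definition precedes u v : bool := (enum_rank u < enum_rank v)%N.

Lemma precedes_total u v : adj u v -> precedes v u = ~~ precedes u v.
Proof.
move=> uv; have : u != v by apply: contraTneq uv => ->; rewrite adj_irr.
by rewrite /precedes -(inj_eq enum_rank_inj) -val_eqE /=; case: ltngtP.
Qed.

Definition edge_parametrization (g : G -> G -> R -> plane) := forall u v, adj u v ->
  [/\ g u v 0 = pt u, edge_arc u v = g u v @` `[0, 1], {in `[0, 1] &, injective (g u v)},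
      forall t, g v u t = g u v (1 - t) &
      forall s t, 0 <= s -> t <= 1 -> compact (g u v @` `[s, t]) /\ connected (g u v @` `[s, t])].

Lemma subarc_continuum (f : R -> plane) s t : {within `[0, 1], continuous f} ->
  0 <= s -> t <= 1 -> compact (f @` `[s, t]) /\ connected (f @` `[s, t]).
Proof.
move=> f_cts s_ge0 t_le1; have {}f_cts : {within `[s, t], continuous f}.
  apply: continuous_subspaceW f_cts => r /=; rewrite !in_itv /= => /andP[sr rt].
  by rewrite (le_trans s_ge0 sr) (le_trans rt t_le1).
split; first by apply: continuous_compact => //; exact: segment_compact.
by apply: connected_continuous_connected => //; exact: segment_connected.
Qed.

Lemma edge_parametrization_exists : exists g, edge_parametrization g.
Proof.
pose spec (p : G * G) (f : R -> plane) := adj p.1 p.2 ->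
  [/\ {within `[0, 1], continuous f}, {in `[0, 1] &, injective f},
      f 0 = pt p.1, f 1 = pt p.2 & edge_arc p.1 p.2 = f @` `[0, 1]].
have spec_exists p : exists f, spec p f.
  have [uv|nuv] := boolP (adj p.1 p.2); last by exists (fun=> 0) => uv; rewrite uv in nuv.
  by have [f f_arc] := edge_arcP uv; exists f.
have [f f_spec] := choice spec_exists.
exists (fun u v t => if precedes u v then f (u, v) t else f (v, u) (1 - t)) => u v uv.
rewrite (precedes_total uv); case: (boolP (precedes u v)) => /= [_|_].
  have [f_cts f_inj f0 f1 f_img] := f_spec (u, v) uv.
  by split=> // s t; apply: subarc_continuum.
have vu : adj v u by rewrite adj_sym.
have [f_cts f_inj f0 f1 f_img] := f_spec (v, u) vu.
split.
- by rewrite subr0 f1.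
- by rewrite edge_arcC // f_img image_itv_flip subrr subr0.
- move=> s t; rewrite !in_itv /= => s01 t01 /f_inj st; apply/eqP; rewrite -subr_eq0.
  have : 1 - s = 1 - t by apply: st; rewrite in_itv /=; lra.
  by move=> st'; apply/eqP; lra.
- by move=> t; rewrite subKr.
- move=> s t s_ge0 t_le1; rewrite image_itv_flip; apply: subarc_continuum => //; lra.
Qed.

Section Parametrized.
Variable g : G -> G -> R -> plane.
Hypothesis gP : edge_parametrization g.

Lemma arc_end u v : adj u v -> g u v 1 = pt v.
Proof.
move=> uv; have vu : adj v u by rewrite adj_sym.
by have [<- _ _ _ _] := gP vu; have [_ _ _ -> _] := gP uv; rewrite subr0.
Qed.

Lemma mem_edge_arc u v t : adj u v -> 0 <= t <= 1 -> edge_arc u v (g u v t).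
Proof. by move=> uv t01; have [_ -> _ _ _] := gP uv; exists t; rewrite //= in_itv. Qed.

Definition arc_end_at u v t w : Prop := (w = u /\ t = 0) \/ (w = v /\ t = 1).

Lemma arc_vertex u v w t : adj u v -> 0 <= t <= 1 -> g u v t = pt w -> arc_end_at u v t w.
Proof.
move=> uv t01 gt; have [g0 _ g_inj _ _] := gP uv; have g1 := arc_end uv.
have [wE|wE] : w = u \/ w = v.
- apply: contrapT => w_neq; apply: (@edge_arc_pt _ G u v w uv); split.
    by rewrite -gt; apply: mem_edge_arc.
  by case=> /pt_inj ?; apply: w_neq; [left|right].
- by left; split=> //; apply: g_inj; rewrite ?in_itv //= ?lexx ?ler01 // gt g0 wE.
- by right; split=> //; apply: g_inj; rewrite ?in_itv //= ?lexx ?ler01 // gt g1 wE.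
Qed.

Lemma arc_meet a b c d s t : adj a b -> adj c d -> 0 <= s <= 1 -> 0 <= t <= 1 ->
  g a b s = g c d t ->
  [\/ [/\ a = c, b = d & s = t], [/\ a = d, b = c & s = 1 - t] |
      exists2 w, arc_end_at a b s w & arc_end_at c d t w].
Proof.
move=> ab cd s01 t01 gst; have [_ _ g_inj g_flip _] := gP ab.
have [/eqP/setP same|differ] := boolP ([set a; b] == [set c; d])%SET.
  have t01' : 1 - t \in `[0, 1] by rewrite in_itv /=; lra.
  have ab_neq : a != b by apply: contraTneq ab => ->; rewrite adj_irr.
  have := same a; have := same b; rewrite !inE !eqxx orbT => /esym/orP[]/eqP bE /esym/orP[]/eqP aE.
  - by rewrite aE bE eqxx in ab_neq.
  - constructor 2; split=> //; apply: g_inj; rewrite ?in_itv //.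
    by rewrite gst -g_flip aE bE.
  - constructor 1; split=> //; apply: g_inj; rewrite ?in_itv //.
    by rewrite gst aE bE.
  - by rewrite aE bE eqxx in ab_neq.
constructor 3.
have [w gw] : exists w, g a b s = pt w.
  apply: contrapT => no_vertex.
  have : ((edge_arc a b `\` [set pt a; pt b]) `&` edge_arc c d) (g a b s).
    split; last by rewrite gst; apply: mem_edge_arc.
    by split; [exact: mem_edge_arc|case=> gE; apply: no_vertex; [exists a|exists b]].
  by rewrite edge_arc_disj.
by exists w; [apply: arc_vertex gw|apply: arc_vertex => //; rewrite -gst].
Qed.

Definition star v : set plane :=
  [set x | x = pt v \/ exists u t, [/\ adj v u, 0 <= t <= 3^-1 & x = g v u t]].

Definition middle_third u v : set plane := g u v @` `[3^-1, 2 / 3].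

Lemma star_pt v : star v (pt v). Proof. by left. Qed.

Lemma arc_end_at_start u v t w : arc_end_at u v t w -> t <= 3^-1 -> w = u.
Proof. by case=> [[]//|[_ ->] ?]; exfalso; lra. Qed.

Lemma arc_end_at_middle u v t w : arc_end_at u v t w -> 3^-1 <= t -> t <= 2 / 3 -> False.
Proof. by case=> [[_ ->]|[_ ->]]; lra. Qed.

Lemma star_disjoint u v : star u `&` star v !=set0 -> u = v.
Proof.
case=> x [[xu|[a [s [ua s_le xs]]]] [xv|[b [t [vb t_le xt]]]]].
- by apply: pt_inj; rewrite -xu xv.
- have [t01 t13] : 0 <= t <= 1 /\ t <= 3^-1 by split; lra.
  by apply: arc_end_at_start t13; apply: (arc_vertex vb t01); rewrite -xt.
- have [s01 s13] : 0 <= s <= 1 /\ s <= 3^-1 by split; lra.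
  by apply/esym; apply: arc_end_at_start s13; apply: (arc_vertex ua s01); rewrite -xs.
have [[s01 s13] [t01 t13]] : (0 <= s <= 1 /\ s <= 3^-1) /\ (0 <= t <= 1 /\ t <= 3^-1).
  by split; split; lra.
have [[]//|[_ _ st]|[w ws wt]] := arc_meet ua vb s01 t01 (etrans (esym xs) xt).
  by exfalso; lra.
by rewrite -(arc_end_at_start ws s13) (arc_end_at_start wt t13).
Qed.

Lemma middle_third_star a b v : adj a b -> middle_third a b `&` star v !=set0 -> v = a \/ v = b.
Proof.
move=> ab [x [[s /=]]]; rewrite in_itv /= => /andP[s_ge s_le] <-.
have s01 : 0 <= s <= 1 by lra.
case=> [gv|[u [t [vu t_le gt]]]].
  by case: (arc_end_at_middle (arc_vertex ab s01 gv) s_ge s_le).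
have t01 : 0 <= t <= 1 by lra.
have [[]|[]|[w ws _]] := arc_meet ab vu s01 t01 gt; [by left|by right|].
by case: (arc_end_at_middle ws s_ge s_le).
Qed.

Lemma middle_third_disjoint a b c d : adj a b -> adj c d -> precedes a b -> precedes c d ->
  middle_third a b `&` middle_third c d !=set0 -> a = c /\ b = d.
Proof.
move=> ab cd lt_ab lt_cd [x [[s /=]]]; rewrite in_itv /= => /andP[s_ge s_le] <-.
case=> t /=; rewrite in_itv /= => /andP[t_ge t_le] gts.
have [s01 t01] : 0 <= s <= 1 /\ 0 <= t <= 1 by split; lra.
have [[]//|[ad bc _]|[w ws _]] := arc_meet ab cd s01 t01 (esym gts).
  by have := precedes_total ab; rewrite lt_ab ad bc lt_cd.
by case: (arc_end_at_middle ws s_ge s_le).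
Qed.

Lemma middle_third_continuum a b : adj a b ->
  compact (middle_third a b) /\ connected (middle_third a b).
Proof. by move=> ab; have [_ _ _ _ continuum] := gP ab; apply: continuum; lra. Qed.

Lemma middle_third_meets_star a b : adj a b ->
  middle_third a b `&` star a !=set0 /\ middle_third a b `&` star b !=set0.
Proof.
move=> ab; have [_ _ _ g_flip _] := gP ab; split.
  exists (g a b 3^-1); split; first by exists 3^-1; rewrite //= in_itv /= lexx; lra.
  by right; exists b, 3^-1; split=> //; lra.
exists (g a b (2 / 3)); split; first by exists (2 / 3); rewrite //= in_itv /= lexx andbT; lra.
right; exists a, 3^-1; rewrite adj_sym; split=> //; first by lra.
by rewrite g_flip; congr (g a b _); lra.
Qed.

Let ray v u : set plane := if adj v u then g v u @` `[0, 3^-1] else [set pt v].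

Let starE v : star v = \bigcup_u ray v u `|` [set pt v].
Proof.
apply/seteqP; split=> x /=.
  case=> [->|[u [t [vu t_le ->]]]]; first by right.
  by left; exists u; rewrite // /ray vu; exists t; rewrite //= in_itv.
case=> [[u _]|->]; last by left.
rewrite /ray; case: ifP => [vu|_ ->]; last by left.
by move=> [t /=]; rewrite in_itv => t_le <-; right; exists u, t.
Qed.

Let ray_continuum v u : [/\ compact (ray v u), connected (ray v u) & ray v u (pt v)].
Proof.
rewrite /ray; case: ifP => [vu|_]; last by split; [exact: compact_set1|exact: connected1|].
have [g0 _ _ _ continuum] := gP vu.
have [|ray_compact ray_conn] := continuum 0 3^-1 (lexx 0); first by lra.
by split=> //; exists 0; rewrite ?g0 //= in_itv /= lexx; lra.
Qed.

Lemma star_compact v : compact (star v).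
Proof.
rewrite starE; apply: compactU; last exact: compact_set1.
by apply: compact_bigcup_fin => u; have [] := ray_continuum v u.
Qed.

Lemma star_connected v : connected (star v).
Proof.
rewrite starE; apply: connectedU; last exact: connected1.
  by exists (pt v); split=> //; exists v => //; have [] := ray_continuum v v.
apply: bigcup_connected => [|u _]; last by have [] := ray_continuum v u.
by exists (pt v) => u _; have [] := ray_continuum v u.
Qed.

Lemma star_drawing v : star v `<=` drawing G.
Proof.
move=> x [->|[u [t [vu t_le ->]]]]; first by left; exists v.
by right; exists v, u; split=> //; apply: mem_edge_arc => //; lra.
Qed.

Lemma middle_third_drawing a b : adj a b -> middle_third a b `<=` drawing G.
Proof.
move=> ab x [t /=]; rewrite in_itv /= => t_mid <-.
by right; exists a, b; split=> //; apply: mem_edge_arc => //; lra.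
Qed.

Lemma drawing_closed : closed (drawing G).
Proof.
pose arc (p : G * G) : set plane := if adj p.1 p.2 then edge_arc p.1 p.2 else set0.
have -> : drawing G = \bigcup_(v : G) [set pt v] `|` \bigcup_p arc p.
  apply/seteqP; split=> x.
    case=> [[v _ <-]|[u [v [uv uvx]]]]; [by left; exists v|right].
    by exists (u, v) => //; rewrite /arc /= uv.
  case=> [[v _ ->]|[[u v] _]]; first by left; exists v.
  by rewrite /arc /=; case: ifP => // uv uvx; right; exists u, v.
apply: compact_closed; first exact: norm_hausdorff.
apply: compactU; apply: compact_bigcup_fin; first by move=> v; exact: compact_set1.
move=> [u v]; rewrite /arc /=; case: ifP => [uv|_]; last exact: compact0.
by have [_ -> _ _ continuum] := gP uv; have [] := continuum 0 1 (lexx 0) (lexx 1).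
Qed.

Definition vertex_clearance r : Prop := forall v,
  [/\ forall w x, w != v -> star w x -> r <= `|x - pt v|,
      forall a b x, adj a b -> middle_third a b x -> r <= `|x - pt v| &
      forall w, w != v -> r + r <= `|pt w - pt v|].

Lemma vertex_clearance_near0 : \forall r \near (0 : R)^'+, vertex_clearance r.
Proof.
have star_gap : \forall r \near (0 : R)^'+, forall v w x, w != v -> star w x -> r <= `|x - pt v|.
  apply: filter_forall => v; apply: filter_forall => w.
  have [->|wv] := eqVneq w v; first by apply: nearW => r x /eqP.
  apply: filterS (compact_point_gap (a := pt v) (@star_compact w) _)
    => [r r_gap x _ /r_gap //|w_pt].
  by case/eqP: wv; apply: star_disjoint; exists (pt v); split; last exact: star_pt.
have middle_gap : \forall r \near (0 : R)^'+,
    forall v a b x, adj a b -> middle_third a b x -> r <= `|x - pt v|.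
  apply: filter_forall => v; apply: filter_forall => a; apply: filter_forall => b.
  have [ab|nab] := boolP (adj a b); last by apply: nearW => r x.
  apply: filterS (compact_point_gap (a := pt v) (middle_third_continuum ab).1 _)
    => [r r_gap x _ /r_gap //|].
  move=> [t /=]; rewrite in_itv /= => /andP[t_ge t_le] /(arc_vertex ab) end_at.
  by apply: (arc_end_at_middle (end_at _) t_ge t_le); lra.
have pt_gap : \forall r \near (0 : R)^'+, forall v w, w != v -> r + r <= `|pt w - pt v|.
  apply: filter_forall => v; apply: filter_forall => w.
  have [->|wv] := eqVneq w v; first by apply: nearW => r /eqP.
  have half_gt0 : 0 < `|pt w - pt v| / 2.
    by rewrite divr_gt0 // normr_gt0 subr_eq0; apply: contraNneq wv => /pt_inj ->.
  by apply: filterS (nbhs_right_le half_gt0) => r r_le _; rewrite [leRHS]splitr lerD.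
apply: filterS3 star_gap middle_gap pt_gap => r r_star r_middle r_pt v.
by split; [apply: r_star|apply: r_middle|apply: r_pt].
Qed.

End Parametrized.

Definition planar_with_outer_vertex : Prop :=
  exists (W : finType) (S : {set W}) (e : rel W) (i : option G -> W),
  [/\ injective i, planar S e, forall u v : G, adj u v -> e (i (Some u)) (i (Some v)) &
      forall v : G, boundary_vertex v -> e (i None) (i (Some v))].

Section Connectors.
Variables (g : G -> G -> R -> plane) (r : R) (probe : G -> plane).
Hypothesis gP : edge_parametrization g.
Hypothesis r_clear : vertex_clearance g r.
Hypothesis probeP : forall v, boundary_vertex v ->
  @outer_face R G (probe v) /\ `|probe v - pt v| < r.

(* An edge is represented by the middle third of its arc, a boundary vertex by a segment to a
   nearby point of the outer face. *)
Let is_connector (k : G * G + G) := match k with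
  | inl p => adj p.1 p.2 && precedes p.1 p.2 | inr v => `[< boundary_vertex v >] end.
Let connector := {k : G * G + G | is_connector k}.
Let connector_set (k : connector) : set plane := match sval k with
  | inl p => middle_third g p.1 p.2 | inr v => line_segment (pt v) (probe v) end.
Let source (k : connector) : G := match sval k with inl p => p.1 | inr v => v end.
Let target (k : connector) : option G := match sval k with inl p => Some p.2 | inr v => None end.

Let segment_near v x : boundary_vertex v -> line_segment (pt v) (probe v) x -> `|x - pt v| < r.
Proof. by move=> /probeP[_ probe_lt] /line_segment_norm x_le; apply: le_lt_trans probe_lt. Qed.

Let connector_continuum k : compact (connector_set k) /\ connected (connector_set k).
Proof.
case: k => -[[a b]|v] k_conn; rewrite /connector_set /=.
  by case/andP: k_conn => /(middle_third_continuum gP).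
by split; [exact: line_segment_compact|exact: line_segment_connected].
Qed.

Let connector_disjoint k k' : connector_set k `&` connector_set k' !=set0 -> k = k'.
Proof.
have middle_segment a b v : adj a b -> boundary_vertex v ->
    middle_third g a b `&` line_segment (pt v) (probe v) !=set0 -> False.
  move=> ab bv [x [ab_x /(segment_near bv)]].
  by have [_ middle_clear _] := r_clear v; rewrite ltNge (middle_clear a b).
case: k k' => -[[a b]|v] k_conn [[[c d]|w] k'_conn]; rewrite /connector_set /= => meet;
  apply/val_inj => /=.
- case/andP: (k_conn) => /= ab lt_ab; case/andP: (k'_conn) => /= cd lt_cd.
  by have [-> ->] := middle_third_disjoint gP ab cd lt_ab lt_cd meet.
- by case/andP: (k_conn) => ab _; case: (middle_segment a b w ab (asboolW k'_conn)).
- by case/andP: (k'_conn) => cd _; rewrite setIC in meet;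
    case: (middle_segment c d v cd (asboolW k_conn)).
congr inr; apply/eqP; apply: contraT => vw.
have [x [/(segment_near (asboolW k_conn)) xv /(segment_near (asboolW k'_conn)) xw]] := meet.
have [_ _ /(_ v vw)] := r_clear w; rewrite leNgt -(subrKA x) => /negP; case.
by apply: le_lt_trans (ler_normD _ _) _; rewrite [`|pt v - x|]distrC ltrD.
Qed.

Let connector_meets_only k v : connector_set k `&` star g v !=set0 ->
  v = source k \/ Some v = target k.
Proof.
case: k => -[[a b]|w] k_conn; rewrite /connector_set /source /target /=.
  by case/andP: (k_conn) => /= ab _ /(middle_third_star gP ab)[->|->]; [left|right].
move=> [x [/(segment_near (asboolW k_conn)) xw vx]]; left; apply/eqP; apply: contraT => vw.
by have [star_clear _ _] := r_clear w; rewrite ltNge (star_clear v) in xw.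
Qed.

Lemma planar_with_outer_vertex_of_probes : planar_with_outer_vertex.
Proof.
have [|||||||||||||||W [S [e [i [i_inj pl e_conn]]]]] :=
  @planar_discretization R G connector (star g) connector_set source target
    _ _ _ _ _ _ _ _ _ _ _ (drawing G).
- exact: star_compact.
- exact: star_connected.
- by move=> v; exists (pt v); exact: star_pt.
- exact: star_disjoint.
- by move=> k; have [] := connector_continuum k.
- by move=> k; have [] := connector_continuum k.
- exact: connector_disjoint.
- case=> -[[a b]|v] k_conn; rewrite /connector_set /source /=.
    by case/andP: k_conn => /= /(middle_third_meets_star gP)[].
  by exists (pt v); split; [exact: line_segment_left|exact: star_pt].
- case=> -[[a b]|v] k_conn w; rewrite /connector_set /target //= => -[<-].
  by case/andP: k_conn => /= /(middle_third_meets_star gP)[].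
- exact: connector_meets_only.
- case=> -[[a b]|v] k_conn; rewrite /source /target //= => -[ab].
  by case/andP: k_conn; rewrite /= ab adj_irr.
- exact: drawing_closed gP.
- exact: star_drawing.
- case=> -[[a b]|v] k_conn; rewrite /connector_set /target //= => _.
  by case/andP: k_conn => /= /(middle_third_drawing gP).
- case=> -[[a b]|v] k_conn; rewrite /connector_set /target //= => _.
  have [[_ unbounded] _] := probeP (asboolW k_conn).
  by exists (probe v) => //; exact: line_segment_right.
exists W, S, e, i; split=> // [u v uv|v /asboolP v_conn]; last first.
  by rewrite (planar_sym pl); apply: (e_conn (exist _ (inr v) v_conn)).
wlog lt_uv : u v uv / precedes u v => [wlog_lt|].
  have [|nlt_uv] := boolP (precedes u v); first exact: wlog_lt.
  by rewrite (planar_sym pl); apply: wlog_lt; [rewrite adj_sym|rewrite precedes_total].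
have uv_conn : is_connector (inl (u, v)) by rewrite /is_connector /= uv.
exact: (e_conn (exist _ (inl (u, v)) uv_conn)).
Qed.

End Connectors.

Lemma plane_graph_planar : planar_with_outer_vertex.
Proof.
have [g gP] := edge_parametrization_exists.
have [r [r_gt0 r_clear]] : exists r, 0 < r /\ vertex_clearance g r.
  apply: (@filter_ex _ (0 : R)^'+).
  by apply: filterS2 (nbhs_right_gt 0) (vertex_clearance_near0 gP) => r.
have probe_exists v : exists q, boundary_vertex v -> @outer_face R G q /\ `|q - pt v| < r.
  have [[v_closure _]|nbv] := pselect (boundary_vertex v); last by exists 0.
  have [q [q_outer q_ball]] := v_closure _ (nbhsx_ballx (pt v) r r_gt0).
  by exists q => _; split=> //; move: q_ball; rewrite -ball_normE /= distrC.
have [probe probeP] := choice probe_exists.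
exact: planar_with_outer_vertex_of_probes gP r_clear probeP.
Qed.

End PlaneGraph.

Lemma boundary_edge_monomial (R : realType) (G : plane_graph R) (u v : G) :
  boundary_edge u v -> exists2 m, monomial (@del_edge_adj G u v) m &
    [/\ m u = 0, m v = 0, forall w : G, boundary_vertex w -> m w <= 2 & forall w, m w <= 4].
Proof.
move=> uv_boundary; have [W [S [e [i [i_inj pl e_adj e_outer]]]]] := plane_graph_planar G.
have [u_outer v_outer] := boundary_edge_vertices uv_boundary; have [uv _] := uv_boundary.
pose j w := i (Some w); pose z := i None.
have j_inj : injective j by move=> x y /i_inj[].
have [m em m_le] := capped_outer_edge (planar_capped pl)
  (e_outer u u_outer) (e_outer v v_outer) (e_adj u v uv).
have j_homo : {homo j : x y / del_edge_adj u v x y >->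
    remove_edge (remove_vertices e [set z]%SET) (j u) (j v) x y}.
  move=> x y /andP[xy not_uv]; rewrite /remove_edge /remove_vertices e_adj // !inE.
  rewrite !(inj_eq i_inj) /same_pair !(inj_eq j_inj) /=.
  by apply: contra not_uv => /orP[]/andP[/eqP -> /eqP ->]; rewrite // finset.setUC.
have outer_irr := remove_edge_irr (j u) (j v) (remove_vertices_irr [set z]%SET (planar_irr pl)).
have [d Gd d_le] := monomial_embed j_inj (@del_edge_sym G u v) (@del_edge_irr G u v)
  outer_irr j_homo em.
have d_cap w : d w <= cap [set j u; j v]%SET (nbhd e z) (j w).
  exact: le_trans (d_le w) (m_le _).
exists d => //; split=> [||w w_outer|w].
- by apply/le_anti; have := d_cap u; rewrite /cap !inE eqxx (monomial_ge0 u Gd) => ->.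
- by apply/le_anti; have := d_cap v; rewrite /cap !inE eqxx orbT (monomial_ge0 v Gd) => ->.
- by apply: le_trans (d_cap w) _; rewrite /cap !inE e_outer //; case: ifP.
- by apply: le_trans (d_cap w) _; rewrite /cap; do 2?case: ifP.
Qed.

Theorem theorem6 (R : realType) (G : plane_graph R) (v1 v2 : G)
    (he : boundary_edge v1 v2) :
  exists D : {set G * G},
    orientation (G := del_edge v1 v2) D /\
    #|EE D| <> #|OE D| /\
    (outdeg D v1 = 0%N /\ outdeg D v2 = 0%N /\
     (forall v : G, boundary_vertex v -> v <> v1 -> v <> v2 ->
        (outdeg D v <= 2)%N) /\
     (forall v : G, interior_vertex v -> (outdeg D v <= 4)%N)).
Proof.
have [m Gm [m1 m2 m_boundary m_le4]] := boundary_edge_monomial he.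
have [D [D_adj D_orient EE_OE outdegE]] := monomial_orientation Gm.
exists D; split=> //; split=> //; split; [|split; [|split=> v]].
- by have := outdegE v1; rewrite m1 => -[].
- by have := outdegE v2; rewrite m2 => -[].
- by move=> /m_boundary + _ _; rewrite -outdegE.
- by move=> _; have := m_le4 v; rewrite -outdegE.
Qed.
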